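(* Let $0\le\lambda\le\rho$, where $0<\rho$. Then $$\gamma^h_\lambda(\rho)\ge\begin{cases}R^h(y^h_{min}(\lambda)), & \text{if }\lambda\le\rho\le x^h(y^h_{min}(\lambda)),\\ R^h\big(x^h|_{H_1}^{-1}(\rho)\big), & \text{if }x^h(y^h_{min}(\lambda))<\rho\le y_s^h(\lambda),\\ R^h_{reg}(\rho), & \text{if } y_s^h(\lambda)<\rho.\end{cases}$$ Furthermore, in the first, second and third case of this bound on $\gamma^h_\lambda(\rho)$ we have equality if there is a $\lambda$-separable packing of hyperbolic disks of radius $\rho$ whose Delaunay triangles tile $\mathbb{H}^2$ and are congruent to $T^h(y^h_{min}(\lambda))$, $T^h(x^h|_{H_1}^{-1}(\rho))$, or $T^h_{reg}(\rho)$, respectively.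
   Context: $\mathbb{H}^2$ is the hyperbolic plane of curvature $-1$. A packing of disks is a family of disks with pairwise disjoint interiors. For $0\le\lambda\le\rho$, a packing $\mathcal P$ of disks of radius $\rho$ is $\lambda$-separable if the family $\mathcal P'$ of disks of radius $\lambda$ concentric to the disks of $\mathcal P$ is totally separable, i.e. any two disks of $\mathcal P'$ can be separated by a line which is disjoint from the interior of every disk of $\mathcal P'$ (separated: lying in different closed half planes bounded by it). $\gamma^h_\lambda(\rho)$ is the smallest $r>0$ such that there is a $\lambda$-separable packing $\mathcal P$ of hyperbolic disks of radius $\rho$ for which the disks of radius $r$ concentric to the disks of $\mathcal P$ cover $\mathbb{H}^2$. For $0<\lambda<y$ put $x^h(y)=\frac12\operatorname{arcsinh}\frac{\cosh\lambda\,\sinh^2y}{\sqrt{\sinh^2y-\sinh^2\lambda}}$. It is strictly decreasing on $H_1=(\lambda,\operatorname{arcsinh}(\sqrt2\sinh\lambda)]$; $x^h|_{H_1}^{-1}$ is the inverse of its restriction to $H_1$. $T^h(y)$ is the hyperbolic isosceles triangle with edge lengths $2y,2x^h(y),2x^h(y)$ and $R^h(y)$ is its circumradius; $T^h_{reg}(\rho)$ is the regular hyperbolic triangle of edge length $2\rho$ and $R^h_{reg}(\rho)$ its circumradius. Further $$y_s^h(\lambda)=\operatorname{arcsinh}\sqrt{\tfrac{5\sinh^2\lambda-3+\sqrt{25\sinh^4\lambda+34\sinh^2\lambda+9}}{8}},$$ and for $\lambda>0$, with $L=\sinh\lambda$, $$y^h_{min}(\lambda)=\operatorname{arcsinh}\sqrt{\frac{5L^2}{3}+\frac23\sqrt{10L^4+6L^2}\,\cos\left(\frac13\arccos\left(\frac{(25L^2+9)L}{4\sqrt2\,(5L^2+3)^{3/2}}\right)-\frac{2\pi}{3}\right)}.$$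 For $\lambda=0$ one has $y_s^h(0)=0$ and only the third case occurs. The Delaunay triangles of a packing are the triangular cells of the Delaunay decomposition defined by the set $X$ of centers: the locally finite edge-to-edge tiling of $\operatorname{conv}(X)$ by convex polygons with vertices in $X$ such that the circumdisk of each tile contains no point of $X$ in its interior and only the vertices of the tile on its boundary. *)

(* Defs.v *)
(* Stdlib reals with Coquelicot. *)
From Stdlib Require Import Reals List.
From Coquelicot Require Import Coquelicot.
Open Scope R_scope.

(* The hyperboloid model: a point of the sheet t^2 = 1 + x^2 + y^2, t > 0, is
   given by (x, y), its coordinate t being determined by them. *)
Definition hplane : Type := (R * R)%type.

Definition time (p : hplane) : R := sqrt (1 + fst p ^ 2 + snd p ^ 2).

Definition arccosh (u : R) : R := ln (u + sqrt (u ^ 2 - 1)).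

Definition hdist (p q : hplane) : R :=
  arccosh (time p * time q - fst p * fst q - snd p * snd q).

Definition region : Type := hplane -> Prop.

Definition same (A B : region) : Prop := forall p, A p <-> B p.
Definition included (A B : region) : Prop := forall p, A p -> B p.
Definition disjoint (A B : region) : Prop := forall p, ~ (A p /\ B p).
Definition inter (A B : region) : region := fun p => A p /\ B p.
Definition plane : region := fun _ => True.
Definition triple (a b c : hplane) : region := fun p => p = a \/ p = b \/ p = c.

Definition finite (A : region) : Prop :=
  exists s : list hplane, forall p, A p -> In p s.

Definition disk (c : hplane) (r : R) : region := fun p => hdist c p <= r.

Definition interior (A : region) : region :=
  fun p => exists e, 0 < e /\ included (disk p e) A.

(* A line is cut out of the hyperboloid by a plane through the origin whose
   normal vector is spacelike. *)
Record line : Type := Line {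
  nx : R; ny : R; nt : R;
  spacelike : nt ^ 2 < nx ^ 2 + ny ^ 2
}.

Definition lform (l : line) (p : hplane) : R :=
  nx l * fst p + ny l * snd p - nt l * time p.

Definition on_line (l : line) : region := fun p => lform l p = 0.
Definition half_plane_pos (l : line) : region := fun p => 0 <= lform l p.
Definition half_plane_neg (l : line) : region := fun p => lform l p <= 0.

Definition segment (a b : hplane) : region :=
  fun p => hdist a p + hdist p b = hdist a b.

Definition convex (A : region) : Prop :=
  forall a b, A a -> A b -> included (segment a b) A.

Definition conv (A : region) : region :=
  fun p => forall C, convex C -> included A C -> C p.

(* As the common radius of the disks is fixed, a family of disks is given by
   the set X of its centers. *)
Definition packing (rho : R) (X : region) : Prop :=
  forall a b, X a -> X b -> a <> b ->
    disjoint (interior (disk a rho)) (interior (disk b rho)).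

Definition totally_separable (lam : R) (X : region) : Prop :=
  forall a b, X a -> X b -> a <> b ->
    exists l : line,
      included (disk a lam) (half_plane_pos l) /\
      included (disk b lam) (half_plane_neg l) /\
      forall c, X c -> disjoint (on_line l) (interior (disk c lam)).

Definition separable_packing (lam rho : R) (X : region) : Prop :=
  packing rho X /\ totally_separable lam X.

Definition covers (r : R) (X : region) : Prop :=
  forall p, exists c, X c /\ disk c r p.

Definition admissible (lam rho r : R) : Prop :=
  0 < r /\ exists X, separable_packing lam rho X /\ covers r X.

(* The infimum of the admissible radii, p_infty if there are none. *)
Definition gamma (lam rho : R) : Rbar := Glb_Rbar (admissible lam rho).

(* A convex polygon is given by its set of vertices V; as a region it is
   conv V. *)
Definition polygon (V : region) : Prop :=
  finite V /\
  (exists p, interior (conv V) p) /\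
  forall v, V v -> ~ conv (fun p => V p /\ p <> v) v.

Definition edge (V : region) (a b : hplane) : Prop :=
  V a /\ V b /\ a <> b /\
  exists l : line,
    on_line l a /\ on_line l b /\ included V (half_plane_pos l).

Definition tiles (D : region -> Prop) (S : region) : Prop :=
  (forall V, D V -> polygon V) /\
  (forall p, S p <-> exists V, D V /\ conv V p) /\
  (forall V W, D V -> D W -> ~ same V W ->
     disjoint (interior (conv V)) (interior (conv W))).

Definition locally_finite (D : region -> Prop) : Prop :=
  forall p, exists e, 0 < e /\ exists s : list region,
    forall V, D V -> ~ disjoint (disk p e) (conv V) ->
      exists W, In W s /\ same V W.

Definition edge_to_edge (D : region -> Prop) : Prop :=
  forall V W, D V -> D W -> ~ same V W ->
    disjoint (conv V) (conv W) \/
    (exists v, V v /\ W v /\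
       same (inter (conv V) (conv W)) (fun p => p = v)) \/
    (exists a b, edge V a b /\ edge W a b /\
       same (inter (conv V) (conv W)) (segment a b)).

Definition empty_circumdisk (X V : region) : Prop :=
  exists o r,
    (forall v, V v -> hdist o v = r) /\
    (forall p, X p -> ~ interior (disk o r) p) /\
    (forall p, X p -> hdist o p = r -> V p).

Definition delaunay_decomposition (X : region) (D : region -> Prop) : Prop :=
  tiles D (conv X) /\ locally_finite D /\ edge_to_edge D /\
  forall V, D V -> included V X /\ empty_circumdisk X V.

Definition triangular (V : region) : Prop :=
  exists a b c, a <> b /\ b <> c /\ a <> c /\ same V (triple a b c).

Definition isometry (f : hplane -> hplane) : Prop :=
  (forall p q, hdist (f p) (f q) = hdist p q) /\
  forall q, exists p, f p = q.

Definition congruent (V W : region) : Prop :=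
  exists f, isometry f /\ forall q, W q <-> exists p, V p /\ f p = q.

(* T : region -> Prop is a congruence class of triangles. *)
Definition delaunay_triangles_tile (X : region) (T : region -> Prop) : Prop :=
  exists D, delaunay_decomposition X D /\
    tiles (fun V => D V /\ triangular V) plane /\
    forall V, D V -> triangular V -> exists W, T W /\ congruent V W.

Definition triangle_with_edges (e1 e2 e3 : R) (T : region) : Prop :=
  exists a b c, same T (triple a b c) /\
    hdist a b = e1 /\ hdist b c = e2 /\ hdist c a = e3.

Definition circumradius (T : region) (r : R) : Prop :=
  exists o, forall v, T v -> hdist o v = r.

(* The common circumradius of the triangles of a congruence class; [iota] is
   Coquelicot's definite description. *)
Definition class_circumradius (T : region -> Prop) : R :=
  iota (fun r : R => exists W, T W /\ circumradius W r).

Definition xh (lam y : R) : R :=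
  / 2 * arcsinh (cosh lam * sinh y ^ 2 / sqrt (sinh y ^ 2 - sinh lam ^ 2)).

Definition H1_interval (lam y : R) : Prop :=
  lam < y <= arcsinh (sqrt 2 * sinh lam).

Definition xh_inv (lam rho : R) : R :=
  iota (fun y : R => H1_interval lam y /\ xh lam y = rho).

Definition Th (lam y : R) : region -> Prop :=
  triangle_with_edges (2 * y) (2 * xh lam y) (2 * xh lam y).

Definition Rh (lam y : R) : R := class_circumradius (Th lam y).

Definition Th_reg (rho : R) : region -> Prop :=
  triangle_with_edges (2 * rho) (2 * rho) (2 * rho).

Definition Rh_reg (rho : R) : R := class_circumradius (Th_reg rho).

Definition ys (lam : R) : R :=
  arcsinh (sqrt ((5 * sinh lam ^ 2 - 3 +
    sqrt (25 * sinh lam ^ 4 + 34 * sinh lam ^ 2 + 9)) / 8)).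

Definition ymin (lam : R) : R :=
  let L := sinh lam in
  arcsinh (sqrt (5 * L ^ 2 / 3 + 2 / 3 * sqrt (10 * L ^ 4 + 6 * L ^ 2) *
    cos (/ 3 * acos ((25 * L ^ 2 + 9) * L /
                     (4 * sqrt 2 * Rpower (5 * L ^ 2 + 3) (3 / 2)))
         - 2 * PI / 3))).

(* [case1] and [case2] need 0 < lam: they involve xh and ymin, which are
   defined for positive lam. *)
Definition case1 (lam rho : R) : Prop :=
  0 < lam /\ lam <= rho <= xh lam (ymin lam).
Definition case2 (lam rho : R) : Prop :=
  0 < lam /\ xh lam (ymin lam) < rho <= ys lam.
Definition case3 (lam rho : R) : Prop := ys lam < rho.

(* A bound b is an equality when it is itself the smallest admissible
   radius. *)
Definition gamma_eq (lam rho b : R) : Prop :=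
  gamma lam rho = Finite b /\ admissible lam rho b.

Definition has_tiling_packing (lam rho : R) (T : region -> Prop) : Prop :=
  exists X, separable_packing lam rho X /\ delaunay_triangles_tile X T.

(* Main.v *)
(* If the disks of radius [r] cover the plane, then for every [eps > 0] some
   three centers lie on a circle of radius at most [r + eps], so it suffices to
   bound below the circumradius of a triple of centers.  Write [P], [Q], [S] for
   [sinh^2] of the half edges, [u] for [sinh^2] of the circumradius and
   [l = sinh^2 lambda].  Then [u * heron P Q S = 4 P Q S].  The separating lines
   isolate two of the three vertices, and isolating the common vertex of the
   edges [P] and [Q] means [l (1 + P + Q) <= P Q (1 + (1 + l) / u)] unless the
   circumcenter lies outside the triangle, in which case [u] is large anyway.
   One may then make the triangle isosceles in the same circumcircle, keeping
   the edge between the isolated vertices as base, so that [Y = sinh^2 y]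
   remains the only parameter.  For [l < Y <= 2 l] the derivative of [u] in [Y]
   has the opposite sign of the cubic [crit], whose middle root is
   [sinh^2 (ymin lambda)].

   For the equality statements, each point of a triangle is within the
   circumradius of some vertex. *)

From Stdlib Require Import Reals Lra Psatz Classical.
From Coquelicot Require Import Coquelicot.
(* After Reals, which has its own [interior], [included] and [disjoint]. *)
Require Import Defs.
Open Scope R_scope.

(** * Hyperbolic functions and [arccosh] *)

Lemma cosh_sqr x : cosh x ^ 2 = 1 + sinh x ^ 2.
Proof.
  unfold cosh, sinh; rewrite exp_Ropp.
  field; apply Rgt_not_eq, exp_pos.
Qed.

Lemma cosh_ge_1 x : 1 <= cosh x.
Proof.
  assert (0 < cosh x).
  { unfold cosh; pose proof (exp_pos x); pose proof (exp_pos (- x)); lra. }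
  pose proof (cosh_sqr x); nra.
Qed.

Lemma cosh_plus x y : cosh (x + y) = cosh x * cosh y + sinh x * sinh y.
Proof.
  unfold cosh, sinh; rewrite Ropp_plus_distr, !exp_plus; field.
Qed.

Lemma sinh_plus x y : sinh (x + y) = sinh x * cosh y + cosh x * sinh y.
Proof.
  unfold cosh, sinh; rewrite Ropp_plus_distr, !exp_plus; field.
Qed.

Lemma cosh_double x : cosh (2 * x) = 1 + 2 * sinh x ^ 2.
Proof.
  replace (2 * x) with (x + x) by ring.
  rewrite cosh_plus; pose proof (cosh_sqr x); nra.
Qed.

Lemma sinh_double x : sinh (2 * x) = 2 * sinh x * cosh x.
Proof. replace (2 * x) with (x + x) by ring; rewrite sinh_plus; ring. Qed.

Lemma sinh_pos x : 0 < x -> 0 < sinh x.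
Proof. intros; rewrite <- sinh_0; now apply sinh_lt. Qed.

Lemma sinh_nonneg x : 0 <= x -> 0 <= sinh x.
Proof.
  intros [H | <-]; [now left; apply sinh_pos | rewrite sinh_0; lra].
Qed.

Lemma sinh_le x y : x <= y -> sinh x <= sinh y.
Proof. intros [H | ->]; [now left; apply sinh_lt | lra]. Qed.

Lemma sinh_le_inv x y : sinh x <= sinh y -> x <= y.
Proof.
  intros H; destruct (Rle_lt_dec x y) as [|H']; trivial.
  apply sinh_lt in H'; lra.
Qed.

Lemma arcsinh_pos x : 0 < x -> 0 < arcsinh x.
Proof. intros; rewrite <- arcsinh_0; now apply arcsinh_lt. Qed.

Lemma cosh_lt x y : 0 <= x -> x < y -> cosh x < cosh y.
Proof.
  intros Hx Hy.
  pose proof (sinh_nonneg x Hx); pose proof (sinh_lt x y Hy).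
  pose proof (cosh_ge_1 x); pose proof (cosh_ge_1 y).
  pose proof (cosh_sqr x); pose proof (cosh_sqr y); nra.
Qed.

Lemma cosh_le x y : 0 <= x -> x <= y -> cosh x <= cosh y.
Proof. intros Hx [H | ->]; [left; now apply cosh_lt | lra]. Qed.

Lemma cosh_le_inv x y : 0 <= y -> cosh x <= cosh y -> x <= y.
Proof.
  intros Hy H; destruct (Rle_lt_dec x y) as [|H']; trivial.
  apply (cosh_lt y x Hy) in H'; lra.
Qed.

Lemma cosh_lt_inv x y : 0 <= y -> cosh x < cosh y -> x < y.
Proof.
  intros Hy H; destruct (Rlt_le_dec x y) as [|H']; trivial.
  apply (cosh_le y x Hy) in H'; lra.
Qed.

Lemma arccosh_nonneg u : 1 <= u -> 0 <= arccosh u.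
Proof.
  intros H; unfold arccosh; rewrite <- ln_1; apply ln_le; [lra|].
  pose proof (sqrt_pos (u ^ 2 - 1)); lra.
Qed.

Lemma cosh_arccosh u : 1 <= u -> cosh (arccosh u) = u.
Proof.
  intros H; unfold cosh, arccosh.
  pose proof (sqrt_pos (u ^ 2 - 1)).
  assert (E : sqrt (u ^ 2 - 1) * sqrt (u ^ 2 - 1) = u ^ 2 - 1)
    by (apply sqrt_sqrt; nra).
  rewrite exp_Ropp, exp_ln by lra.
  field_simplify; [|lra].
  apply (Rmult_eq_reg_r (2 * u + 2 * sqrt (u ^ 2 - 1))); [|lra].
  field_simplify; [nra|lra].
Qed.

Lemma arccosh_cosh x : 0 <= x -> arccosh (cosh x) = x.
Proof.
  intros H; pose proof (cosh_ge_1 x).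
  apply Rle_antisym; apply cosh_le_inv;
    rewrite ?cosh_arccosh by trivial; try lra.
  now apply arccosh_nonneg.
Qed.

(** * The Lorentzian form on three-dimensional space and its Gram identities *)

Definition vec : Type := (R * R * R)%type.

(** The signature is such that time-like vectors have positive square: points of the hyperboloid
    have square 1, the form of two of them is [cosh] of their distance, and normals of lines have
    negative square. *)
Definition form (u v : vec) : R :=
  snd u * snd v - fst (fst u) * fst (fst v) - snd (fst u) * snd (fst v).

Definition comb (s : R) (u : vec) (t : R) (v : vec) : vec :=
  (s * fst (fst u) + t * fst (fst v), s * snd (fst u) + t * snd (fst v),
   s * snd u + t * snd v).

(** The Euclidean cross product with its last coordinate negated, which makes it orthogonal to both
    factors for [form]. *)
Definition cross (u v : vec) : vec :=
  (snd (fst u) * snd v - snd u * snd (fst v),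
   snd u * fst (fst v) - fst (fst u) * snd v,
   snd (fst u) * fst (fst v) - fst (fst u) * snd (fst v)).

Lemma form_sym u v : form u v = form v u.
Proof. unfold form; ring. Qed.

Lemma form_comb_l s u t v w :
  form (comb s u t v) w = s * form u w + t * form v w.
Proof. unfold form, comb; simpl; ring. Qed.

Lemma form_comb_r s u t v w :
  form w (comb s u t v) = s * form w u + t * form w v.
Proof. unfold form, comb; simpl; ring. Qed.

Lemma form_cross_l u v : form (cross u v) u = 0.
Proof. unfold form, cross; simpl; ring. Qed.

Lemma form_cross_r u v : form (cross u v) v = 0.
Proof. unfold form, cross; simpl; ring. Qed.

Lemma form_cross_cross u v :
  form (cross u v) (cross u v) = form u u * form v v - form u v ^ 2.
Proof. unfold form, cross; simpl; ring. Qed.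

Lemma gram3_sqr u v w :
  form u u * form v v * form w w + 2 * form u v * form u w * form v w
  - form u u * form v w ^ 2 - form v v * form u w ^ 2 - form w w * form u v ^ 2
  = form (cross u v) w ^ 2.
Proof. unfold form, cross; simpl; ring. Qed.

(* The Gram determinant of four vectors of a 3-dimensional space vanishes. *)
Lemma gram4 a b c n :
  form n n *
  (form a a * form b b * form c c + 2 * form a b * form a c * form b c
   - form a a * form b c ^ 2 - form b b * form a c ^ 2 - form c c * form a b ^ 2)
  = form a n ^ 2 * (form b b * form c c - form b c ^ 2)
  + form b n ^ 2 * (form a a * form c c - form a c ^ 2)
  + form c n ^ 2 * (form a a * form b b - form a b ^ 2)
  + 2 * form a n * form b n * (form a c * form b c - form a b * form c c)
  + 2 * form a n * form c n * (form a b * form b c - form a c * form b b)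
  + 2 * form b n * form c n * (form a b * form a c - form b c * form a a).
Proof.
  destruct a as [[] ?], b as [[] ?], c as [[] ?], n as [[] ?].
  unfold form; simpl; ring.
Qed.

(** * Points of the hyperboloid and their distances *)

Definition emb (p : hplane) : vec := (fst p, snd p, time p).

Definition lor (p q : hplane) : R := form (emb p) (emb q).

Lemma hdist_lor p q : hdist p q = arccosh (lor p q).
Proof. reflexivity. Qed.

Lemma time_pos p : 0 < time p.
Proof. apply sqrt_lt_R0; pose proof (pow2_ge_0 (fst p)); pose proof (pow2_ge_0 (snd p)); lra. Qed.

Lemma time_sqr p : time p ^ 2 = 1 + fst p ^ 2 + snd p ^ 2.
Proof.
  unfold time; rewrite pow2_sqrt; trivial.
  pose proof (pow2_ge_0 (fst p)); pose proof (pow2_ge_0 (snd p)); lra.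
Qed.

Lemma lor_sym p q : lor p q = lor q p.
Proof. apply form_sym. Qed.

Lemma lor_refl p : lor p p = 1.
Proof. unfold lor, form, emb; cbn [fst snd]; pose proof (time_sqr p); lra. Qed.

(** A Lagrange identity: the three squares left over give [1 <= lor p q], and their vanishing gives
    [p = q] in the case of equality. *)
Lemma time_mul_sqr p q :
  (time p * time q) ^ 2 =
  (1 + fst p * fst q + snd p * snd q) ^ 2 + (fst p - fst q) ^ 2
  + (snd p - snd q) ^ 2 + (fst p * snd q - snd p * fst q) ^ 2.
Proof. rewrite Rpow_mult_distr, !time_sqr; ring. Qed.

Lemma lor_ge_1 p q : 1 <= lor p q.
Proof.
  unfold lor, form, emb; cbn [fst snd].
  pose proof (time_mul_sqr p q) as E.
  pose proof (Rmult_lt_0_compat _ _ (time_pos p) (time_pos q)).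
  set (s := time p * time q) in *; clearbody s.
  pose proof (pow2_ge_0 (fst p - fst q)); pose proof (pow2_ge_0 (snd p - snd q));
    pose proof (pow2_ge_0 (fst p * snd q - snd p * fst q)).
  set (z := fst p * fst q) in *; set (z' := snd p * snd q) in *.
  apply Rnot_lt_le; intros Hs.
  assert (s < 1 + z + z') by lra; nra.
Qed.

(** The second hypothesis selects the upper sheet: by the reverse Cauchy-Schwarz inequality a unit
    vector of the lower sheet has negative form with every point. *)
Lemma emb_surj v p : form v v = 1 -> 0 < form v (emb p) ->
  exists q, emb q = v.
Proof.
  destruct v as [[x y] t]; unfold form, emb; cbn [fst snd]; intros H1 H2.
  exists (x, y); unfold time; cbn [fst snd].
  assert (0 < t).
  { apply Rnot_le_lt; intros Ht.
    pose proof (time_pos p); pose proof (time_sqr p) as E.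
    set (a := fst p) in *; set (b := snd p) in *; set (s := time p) in *.
    clearbody a b s.
    assert (x * a + y * b < t * s) by lra.
    assert (t * s <= 0) by nra.
    assert ((t * s) ^ 2 <= (x * a + y * b) ^ 2) by nra.
    pose proof (pow2_ge_0 (x * b - y * a)).
    assert ((t * s) ^ 2 = (1 + x ^ 2 + y ^ 2) * (1 + a ^ 2 + b ^ 2))
      by (rewrite Rpow_mult_distr, E; f_equal; lra).
    pose proof (pow2_ge_0 x); pose proof (pow2_ge_0 y);
    pose proof (pow2_ge_0 a); pose proof (pow2_ge_0 b); nra. }
  repeat f_equal.
  replace (1 + x ^ 2 + y ^ 2) with (t * t) by lra.
  apply sqrt_square; lra.
Qed.

Lemma lor_eq_1 p q : lor p q = 1 -> p = q.
Proof.
  unfold lor, form, emb; cbn [fst snd]; intros E.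
  pose proof (time_mul_sqr p q) as E2.
  replace (time p * time q) with (1 + fst p * fst q + snd p * snd q) in E2 by lra.
  pose proof (pow2_ge_0 (fst p - fst q)); pose proof (pow2_ge_0 (snd p - snd q));
    pose proof (pow2_ge_0 (fst p * snd q - snd p * fst q)).
  destruct p as [a b], q as [c d]; cbn [fst snd] in *.
  f_equal; apply Rminus_diag_uniq; apply Rsqr_0_uniq; unfold Rsqr; lra.
Qed.

Lemma hdist_nonneg p q : 0 <= hdist p q.
Proof. apply arccosh_nonneg, lor_ge_1. Qed.

Lemma cosh_hdist p q : cosh (hdist p q) = lor p q.
Proof. apply cosh_arccosh, lor_ge_1. Qed.

Lemma hdist_sym p q : hdist p q = hdist q p.
Proof. rewrite !hdist_lor, lor_sym; trivial. Qed.

Lemma hdist_eq p q r : 0 <= r -> lor p q = cosh r -> hdist p q = r.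
Proof. intros H E; rewrite hdist_lor, E; now apply arccosh_cosh. Qed.

Lemma hdist_le p q r : 0 <= r -> hdist p q <= r <-> lor p q <= cosh r.
Proof.
  intros H; rewrite <- cosh_hdist; split; intros.
  - apply cosh_le; trivial; apply hdist_nonneg.
  - now apply cosh_le_inv.
Qed.

Lemma hdist_lt p q r : 0 <= r -> lor p q < cosh r -> hdist p q < r.
Proof. intros; apply cosh_lt_inv; trivial; now rewrite cosh_hdist. Qed.

Lemma gram_lor_nonneg p q s :
  0 <= 1 + 2 * lor p q * lor p s * lor q s
       - lor p q ^ 2 - lor p s ^ 2 - lor q s ^ 2.
Proof.
  pose proof (gram3_sqr (emb p) (emb q) (emb s)) as G.
  fold (lor p p) (lor q q) (lor s s) (lor p q) (lor p s) (lor q s) in G.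
  rewrite !lor_refl in G.
  pose proof (pow2_ge_0 (form (cross (emb p) (emb q)) (emb s))); lra.
Qed.

(** With [u], [v], [w] the values of [cosh] at the three distances, nonnegativity of the Gram
    determinant reads [(w - u * v) ^ 2 <= (u ^ 2 - 1) * (v ^ 2 - 1)], and the addition formula for
    [cosh] concludes. *)
Lemma hdist_triangle p q s : hdist p s <= hdist p q + hdist q s.
Proof.
  pose proof (hdist_nonneg p q) as Hp; pose proof (hdist_nonneg q s) as Hq.
  apply cosh_le_inv; [lra|].
  pose proof (gram_lor_nonneg p q s) as G.
  rewrite cosh_plus, !cosh_hdist.
  pose proof (cosh_sqr (hdist p q)) as Ep; pose proof (cosh_sqr (hdist q s)) as Eq.
  pose proof (Rmult_le_pos _ _ (sinh_nonneg _ Hp) (sinh_nonneg _ Hq)).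
  rewrite cosh_hdist in *.
  set (u := lor p q) in *; set (v := lor q s) in *; set (w := lor p s) in *.
  set (x := sinh (hdist p q)) in *; set (y := sinh (hdist q s)) in *.
  assert ((w - u * v) ^ 2 <= (x * y) ^ 2).
  { replace ((x * y) ^ 2) with ((u ^ 2 - 1) * (v ^ 2 - 1))
      by (rewrite Ep, Eq; ring); nra. }
  apply Rnot_lt_le; intros Hl; nra.
Qed.

(** * Bisectors, packings and separating lines in terms of the form *)

Lemma disk_interior c p r : hdist c p < r -> interior (disk c r) p.
Proof.
  intros H; exists (r - hdist c p); split; [lra|].
  intros q Hq; unfold disk in *.
  pose proof (hdist_triangle c p q); lra.
Qed.

Lemma lor_gt_1 p q : p <> q -> 1 < lor p q.
Proof.
  intros H; destruct (lor_ge_1 p q) as [|E]; trivial.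
  now destruct H; apply lor_eq_1.
Qed.

(** The point of the perpendicular bisector at signed distance [t] from the midpoint: the normalized
    sum of [a] and [b] is the midpoint, and the normalized cross product is the unit tangent there
    orthogonal to the segment. *)
Lemma bisector_point a b t : a <> b -> exists m, forall c,
  lor m c = cosh t * ((lor a c + lor b c) / sqrt (2 + 2 * lor a b))
            + sinh t * (form (cross (emb a) (emb b)) (emb c)
                        / sqrt (lor a b ^ 2 - 1)).
Proof.
  intros Hab; pose proof (lor_gt_1 a b Hab) as HA.
  pose proof (form_cross_cross (emb a) (emb b)) as E3.
  pose proof (form_cross_l (emb a) (emb b)) as E1.
  pose proof (form_cross_r (emb a) (emb b)) as E2.
  fold (lor a a) (lor b b) (lor a b) in E3; rewrite !lor_refl in E3.
  assert (S1 : sqrt (2 + 2 * lor a b) ^ 2 = 2 + 2 * lor a b)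
    by (apply pow2_sqrt; lra).
  assert (S2 : sqrt (lor a b ^ 2 - 1) ^ 2 = lor a b ^ 2 - 1)
    by (apply pow2_sqrt; nra).
  assert (P1 : 0 < sqrt (2 + 2 * lor a b)) by (apply sqrt_lt_R0; lra).
  assert (P2 : 0 < sqrt (lor a b ^ 2 - 1)) by (apply sqrt_lt_R0; nra).
  set (N := sqrt (2 + 2 * lor a b)) in *; set (K := sqrt (lor a b ^ 2 - 1)) in *.
  set (w := cross (emb a) (emb b)) in *.
  set (v := comb (cosh t / N) (comb 1 (emb a) 1 (emb b)) (sinh t / K) w).
  assert (F : forall u, form v u = cosh t * ((form (emb a) u + form (emb b) u) / N)
                                   + sinh t * (form w u / K)).
  { intros u; unfold v; rewrite !form_comb_l; field; lra. }
  destruct (emb_surj v a) as [m Hm].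
  - rewrite F; unfold v; rewrite !form_comb_r.
    rewrite (form_sym (emb a) w), (form_sym (emb b) w), E1, E2, E3.
    fold (lor a a) (lor b b) (lor a b) (lor b a).
    rewrite !lor_refl, (lor_sym b a).
    pose proof (cosh_sqr t) as Et.
    replace (1 * 1 - lor a b ^ 2) with (- K ^ 2) by lra.
    replace (lor a b) with (N ^ 2 / 2 - 1) by lra.
    transitivity (cosh t ^ 2 - sinh t ^ 2); [field|]; lra.
  - rewrite F, E1; fold (lor a a) (lor b a); rewrite lor_refl, (lor_sym b a).
    unfold Rdiv; rewrite Rmult_0_l, Rmult_0_r, Rplus_0_r.
    pose proof (cosh_ge_1 t).
    apply Rmult_lt_0_compat; [lra|].
    apply Rmult_lt_0_compat; [lra|]; now apply Rinv_0_lt_compat.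
  - exists m; intros c; unfold lor; rewrite Hm; apply F.
Qed.

(** If two centers were closer than [2 * rho], their midpoint would lie in the interiors of both
    disks. *)
Lemma packing_lor rho X a b : 0 <= rho -> packing rho X -> X a -> X b ->
  a <> b -> cosh (2 * rho) <= lor a b.
Proof.
  intros Hr HX Ha Hb Hab; apply Rnot_lt_le; intros Hl.
  destruct (bisector_point a b 0 Hab) as [m Hm].
  rewrite cosh_0, sinh_0 in Hm.
  pose proof (lor_gt_1 a b Hab) as HA.
  assert (S1 : sqrt (2 + 2 * lor a b) ^ 2 = 2 + 2 * lor a b)
    by (apply pow2_sqrt; lra).
  assert (P1 : 0 < sqrt (2 + 2 * lor a b)) by (apply sqrt_lt_R0; lra).
  set (N := sqrt (2 + 2 * lor a b)) in *.
  assert (D : forall x, x = a \/ x = b -> hdist x m < rho).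
  { intros x Hx; apply hdist_lt; trivial.
    rewrite lor_sym, Hm.
    replace (lor a x + lor b x) with (N * (N / 2)).
    - apply Rle_lt_trans with (N / 2); [right; rewrite Rmult_0_l; field; lra|].
      pose proof (cosh_ge_1 rho); rewrite cosh_double in Hl.
      pose proof (cosh_sqr rho).
      apply Rnot_le_lt; intros Hn.
      assert (4 * cosh rho ^ 2 <= N ^ 2) by nra; lra.
    - destruct Hx as [-> | ->]; rewrite lor_refl, ?(lor_sym b a); lra. }
  apply (HX a b Ha Hb Hab m).
  split; apply disk_interior, D; auto.
Qed.

Definition normal (l : line) : vec := (nx l, ny l, nt l).

Lemma lform_normal l p : lform l p = - form (normal l) (emb p).
Proof. unfold lform, form, normal, emb; cbn [fst snd]; ring. Qed.

(** Otherwise the foot of the perpendicular from [c] to the line is at distance less than [lam] from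
    [c], hence in the interior of the disk. *)
Lemma line_avoids_disk l c lam : 0 <= lam ->
  disjoint (on_line l) (interior (disk c lam)) ->
  sinh lam ^ 2 * - form (normal l) (normal l) <= lform l c ^ 2.
Proof.
  intros Hlam HD; apply Rnot_lt_le; intros Hl.
  rewrite lform_normal in Hl.
  set (n := normal l) in *; set (s := form n (emb c)) in *.
  set (M := - form n n) in *.
  assert (HM : 0 < M).
  { unfold M, n, form, normal; cbn [fst snd]; pose proof (spacelike l); lra. }
  assert (Hs : 0 <= s ^ 2 / M).
  { apply Rdiv_le_0_compat; trivial; apply pow2_ge_0. }
  assert (Hk : sqrt (1 + s ^ 2 / M) ^ 2 = 1 + s ^ 2 / M)
    by (apply pow2_sqrt; lra).
  assert (Pk : 0 < sqrt (1 + s ^ 2 / M)) by (apply sqrt_lt_R0; lra).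
  set (k := sqrt (1 + s ^ 2 / M)) in *.
  (* The foot: [c] projected along [n] onto the plane of the line and normalized, so that its form
     with [c] is [k]. *)
  set (v := comb (/ k) (emb c) (s / M / k) n).
  assert (En : form n n = - M) by (unfold M; ring).
  assert (Ec : form (emb c) (emb c) = 1) by apply lor_refl.
  assert (Es : form (emb c) n = s) by apply form_sym.
  assert (Es' : form n (emb c) = s) by reflexivity.
  assert (Evc : form v (emb c) = k).
  { unfold v; rewrite form_comb_l, Ec, Es'.
    transitivity ((1 + s ^ 2 / M) / k); [|rewrite <- Hk]; field; lra. }
  assert (Evn : form v n = 0).
  { unfold v; rewrite form_comb_l, En, Es; field; lra. }
  destruct (emb_surj v c) as [m Hm].
  - transitivity (/ k * form v (emb c) + s / M / k * form v n).
    + exact (form_comb_r _ _ _ _ _).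
    + rewrite Evc, Evn; field; lra.
  - rewrite Evc; trivial.
  - apply (HD m); split.
    + unfold on_line; rewrite lform_normal, Hm; fold n; rewrite form_sym, Evn; ring.
    + apply disk_interior, hdist_lt; trivial.
      rewrite lor_sym; unfold lor; rewrite Hm, Evc.
      pose proof (cosh_ge_1 lam); pose proof (cosh_sqr lam).
      assert (s ^ 2 / M < sinh lam ^ 2).
      { apply Rlt_div_l; trivial.
        replace (s ^ 2) with ((- s) ^ 2) by ring; trivial. }
      nra.
Qed.

Lemma hdist_0 p : hdist p p = 0.
Proof. apply hdist_eq; [lra|]; now rewrite lor_refl, cosh_0. Qed.

(** Since the line avoids every disk, each center is at distance at least [lam] from it, which
    bounds the form with the normal by [k] in absolute value. The half planes fix the signs at [a]
    and [b]; the sign at [c] stays open. *)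
Lemma separating_normal lam X a b c : 0 < lam -> totally_separable lam X ->
  X a -> X b -> X c -> a <> b -> exists n,
    0 < - form n n /\
    let k := sinh lam * sqrt (- form n n) in
    k <= form n (emb a) /\ form n (emb b) <= - k /\
    (k <= form n (emb c) \/ form n (emb c) <= - k).
Proof.
  intros Hlam HX Ha Hb Hc Hab.
  destruct (HX a b Ha Hb Hab) as (l & Hla & Hlb & Hl).
  (* The factor -1 compensates the sign in [lform_normal]. *)
  exists (comb (-1) (normal l) 0 (normal l)).
  assert (HM : 0 < - form (normal l) (normal l)).
  { unfold form, normal; cbn [fst snd]; pose proof (spacelike l); lra. }
  set (n := comb _ _ _ _).
  assert (En : form n n = form (normal l) (normal l))
    by (unfold n; rewrite form_comb_l, !form_comb_r; ring).
  assert (F : forall x, form n (emb x) = lform l x)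
    by (intros x; unfold n; rewrite form_comb_l, lform_normal; ring).
  rewrite En, !F; clearbody n; split; trivial; intros k.
  assert (Hk : 0 < k).
  { apply Rmult_lt_0_compat; [now apply sinh_pos | now apply sqrt_lt_R0]. }
  assert (K : forall x, X x -> k <= lform l x \/ lform l x <= - k).
  { intros x Hx.
    pose proof (line_avoids_disk l x lam (Rlt_le _ _ Hlam) (Hl x Hx)) as H.
    replace (sinh lam ^ 2 * - form (normal l) (normal l)) with (k ^ 2) in H.
    - destruct (Rle_lt_dec 0 (lform l x)); [left | right]; nra.
    - unfold k; rewrite Rpow_mult_distr, pow2_sqrt; lra. }
  assert (0 <= lform l a) by (apply Hla; unfold disk; rewrite hdist_0; lra).
  assert (lform l b <= 0) by (apply Hlb; unfold disk; rewrite hdist_0; lra).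
  destruct (K a Ha); destruct (K b Hb); destruct (K c Hc); lra.
Qed.

(** * Three centers on a circle of bounded radius *)

Lemma far_point a r : 0 <= r -> exists p, r < hdist a p.
Proof.
  intros Hr.
  (* Placing the point on the side of the axis away from [fst a] leaves [lor] at least
     [time (x, 0) = cosh (r + 1)]. *)
  set (s := sinh (r + 1)); set (x := if Rle_dec 0 (fst a) then - s else s).
  exists (x, 0).
  assert (Hs : 0 < s) by (apply sinh_pos; lra).
  assert (Hx : 0 <= - (fst a * x)).
  { unfold x; destruct (Rle_dec 0 (fst a)); nra. }
  assert (Hx2 : x ^ 2 = s ^ 2) by (unfold x; destruct (Rle_dec 0 (fst a)); ring).
  assert (Ht : time (x, 0) = cosh (r + 1)).
  { unfold time; cbn [fst snd]; rewrite Hx2.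
    replace (1 + s ^ 2 + 0 ^ 2) with (cosh (r + 1) ^ 2)
      by (rewrite cosh_sqr; unfold s; ring).
    apply sqrt_pow2; pose proof (cosh_ge_1 (r + 1)); lra. }
  apply Rlt_le_trans with (r + 1); [lra|].
  apply cosh_le_inv; [apply hdist_nonneg|].
  rewrite cosh_hdist; unfold lor, form, emb; cbn [fst snd]; rewrite Ht.
  pose proof (time_sqr a); pose proof (time_pos a); pose proof (cosh_ge_1 (r + 1)).
  pose proof (pow2_ge_0 (fst a)); pose proof (pow2_ge_0 (snd a)).
  assert (1 <= time a) by nra.
  nra.
Qed.

(* If [c] violates the conclusion for [a] and [b], the pair [a], [c] is closer
   than [a], [b] by a definite amount, so the descent stops. *)
Lemma exists_tight_pair d X : 0 < d ->
  (forall a b, X a -> X b -> a <> b -> 1 + d <= lor a b) ->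
  (exists a b, X a /\ X b /\ a <> b) ->
  exists a b, X a /\ X b /\ a <> b /\
    forall c, X c -> c <> a -> c <> b -> 1 + lor a b < lor a c + lor b c.
Proof.
  intros Hd HX (a0 & b0 & Ha0 & Hb0 & Hab0).
  assert (D : forall n a b, X a -> X b -> a <> b -> lor a b < 1 + INR n * d ->
    exists a b, X a /\ X b /\ a <> b /\
    forall c, X c -> c <> a -> c <> b -> 1 + lor a b < lor a c + lor b c).
  { induction n as [|n IH]; intros a b Ha Hb Hab Hn.
    - simpl in Hn; pose proof (lor_ge_1 a b); lra.
    - destruct (classic (forall c, X c -> c <> a -> c <> b ->
        1 + lor a b < lor a c + lor b c)) as [H|H]; [now exists a, b|].
      apply not_all_ex_not in H; destruct H as [c H].
      apply imply_to_and in H; destruct H as [Hc H].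
      apply imply_to_and in H; destruct H as [Hca H].
      apply imply_to_and in H; destruct H as [Hcb H].
      apply (IH a c); auto.
      pose proof (HX b c Hb Hc (not_eq_sym Hcb)).
      rewrite S_INR in Hn; lra. }
  destruct (INR_unbounded (lor a0 b0 / d)) as [n Hn].
  apply (D n a0 b0); trivial.
  apply Rlt_div_l in Hn; lra.
Qed.

(* Walk along the bisector of a tight pair [a], [b], starting from the
   midpoint, to distance [r + eps]: there some other center [c] has become
   closer than [a] and [b], so [c] was equidistant on the way. *)
Lemma exists_cocircular_triple rho r eps X :
  0 < rho -> 0 < r -> 0 < eps -> packing rho X -> covers r X ->
  exists o a b c, X a /\ X b /\ X c /\ a <> b /\ a <> c /\ b <> c /\
    lor o a = lor o b /\ lor o a = lor o c /\ lor o a <= cosh (r + eps).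
Proof.
  intros Hrho Hr Heps HX Hcov.
  assert (Hd : 1 < cosh (2 * rho)).
  { rewrite <- cosh_0; apply cosh_lt; lra. }
  destruct (exists_tight_pair (cosh (2 * rho) - 1) X) as (a & b & Ha & Hb & Hab & Hc).
  - lra.
  - intros a b Ha Hb Hab; pose proof (packing_lor rho X a b (Rlt_le _ _ Hrho) HX Ha Hb Hab); lra.
  (* One disk does not cover the plane, so a point far from [a] is covered by a second center. *)
  - destruct (Hcov (0, 0)) as (a & Ha & _).
    destruct (far_point a r) as [p Hp]; [lra|].
    destruct (Hcov p) as (b & Hb & Hbp).
    exists a, b; repeat split; trivial; intros <-; unfold disk in Hbp; lra.
  - pose proof (lor_gt_1 a b Hab) as HA.
    assert (S1 : sqrt (2 + 2 * lor a b) ^ 2 = 2 + 2 * lor a b)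
      by (apply pow2_sqrt; lra).
    assert (P1 : 0 < sqrt (2 + 2 * lor a b)) by (apply sqrt_lt_R0; lra).
    pose proof (fun t => bisector_point a b t Hab) as Hm.
    set (N := sqrt (2 + 2 * lor a b)) in *.
    set (K := sqrt (lor a b ^ 2 - 1)) in *.
    assert (Ea : (lor a a + lor b a) / N = N / 2).
    { rewrite lor_refl, (lor_sym b a); apply (Rmult_eq_reg_r (2 * N)); [|lra].
      field_simplify; lra. }
    assert (Eb : (lor a b + lor b b) / N = N / 2).
    { rewrite <- Ea, !lor_refl, (lor_sym b a); f_equal; ring. }
    assert (Oab : forall m t, (forall c, lor m c = cosh t * ((lor a c + lor b c) / N)
        + sinh t * (form (cross (emb a) (emb b)) (emb c) / K)) ->
        lor m a = cosh t * (N / 2) /\ lor m b = cosh t * (N / 2)).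
    { intros m t E; rewrite !E, form_cross_l, form_cross_r, Ea, Eb.
      unfold Rdiv; rewrite !Rmult_0_l; lra. }
    (* Tightness of the pair says that the midpoint is farther from every other center than from [a]
       and [b]. *)
    assert (Start : forall c, X c -> c <> a -> c <> b ->
        N / 2 < (lor a c + lor b c) / N).
    { intros c Xc Hca Hcb; apply (Rlt_div_r _ _ _ P1).
      specialize (Hc c Xc Hca Hcb); lra. }
    assert (HN : N / 2 <= cosh (r + eps)).
    { destruct (Hm 0) as [m E]; destruct (Oab m 0 E) as [Oa Ob].
      rewrite cosh_0, Rmult_1_l in Oa, Ob.
      destruct (Hcov m) as (c & Xc & Hcm).
      unfold disk in Hcm; apply hdist_le in Hcm; [|lra].
      rewrite lor_sym in Hcm.
      assert (cosh r < cosh (r + eps)) by (apply cosh_lt; lra).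
      apply Rnot_lt_le; intros Hl.
      assert (Hca : c <> a) by (intros ->; lra).
      assert (Hcb : c <> b) by (intros ->; lra).
      specialize (Start c Xc Hca Hcb).
      rewrite E, cosh_0, sinh_0 in Hcm; lra. }
    (* At parameter [t] the bisector point is at distance exactly [r + eps] from [a] and [b], so the
       center covering it is a third one. *)
    set (t := arccosh (2 * cosh (r + eps) / N)).
    assert (Ht1 : 1 <= 2 * cosh (r + eps) / N) by (apply (Rle_div_r _ _ _ P1); lra).
    assert (Ht0 : 0 <= t) by (now apply arccosh_nonneg).
    assert (Ht : cosh t * (N / 2) = cosh (r + eps)).
    { unfold t; rewrite cosh_arccosh by trivial; field; lra. }
    destruct (Hm t) as [m E]; destruct (Oab m t E) as [Oa Ob].
    destruct (Hcov m) as (c & Xc & Hcm).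
    unfold disk in Hcm; apply hdist_le in Hcm; [|lra].
    rewrite lor_sym in Hcm.
    assert (cosh r < cosh (r + eps)) by (apply cosh_lt; lra).
    assert (Hca : c <> a) by (intros ->; lra).
    assert (Hcb : c <> b) by (intros ->; lra).
    specialize (Start c Xc Hca Hcb).
    (* [g s] is [lor m c - lor m a] for the bisector point [m] at parameter [s]; a zero of [g] is a
       circumcenter. *)
    set (g := fun s => cosh s * ((lor a c + lor b c) / N - N / 2)
        + sinh s * (form (cross (emb a) (emb b)) (emb c) / K)).
    assert (G0 : 0 < g 0) by (unfold g; rewrite cosh_0, sinh_0; lra).
    assert (Gt : g t < 0).
    { apply Rle_lt_trans with (lor m c - lor m a); [|lra].
      right; rewrite Oa, E; unfold g; ring. }
    destruct (IVT_gen g 0 t 0) as (s & Hs & Gs).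
    + unfold g; apply (continuity_plus (fun s => cosh s * _) (fun s => sinh s * _)).
      * apply (continuity_mult cosh (fun _ => _)).
        -- apply derivable_continuous, derivable_cosh.
        -- apply continuity_const; intros ? ?; trivial.
      * apply (continuity_mult sinh (fun _ => _)).
        -- apply derivable_continuous, derivable_sinh.
        -- apply continuity_const; intros ? ?; trivial.
    + rewrite Rmin_right, Rmax_left; lra.
    + rewrite Rmin_left, Rmax_right in Hs by trivial.
      destruct (Hm s) as [o Eo]; destruct (Oab o s Eo) as [Oa' Ob'].
      exists o, a, b, c; repeat split; auto.
      * rewrite Oa', Ob'; trivial.
      * rewrite Oa', Eo; unfold g in Gs; lra.
      * rewrite Oa', <- Ht; apply Rmult_le_compat_r; [lra|].
        apply cosh_le; lra.
Qed.

(** * Circumradius and separation in terms of half gaps *)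

Definition half_gap (p q : hplane) : R := (lor p q - 1) / 2.

Lemma half_gap_sym p q : half_gap p q = half_gap q p.
Proof. unfold half_gap; now rewrite lor_sym. Qed.

Lemma half_gap_sinh p q x : lor p q = cosh (2 * x) -> half_gap p q = sinh x ^ 2.
Proof. unfold half_gap; intros ->; rewrite cosh_double; field. Qed.

(* Sixteen times the squared area of a Euclidean triangle with squared edge
   lengths [P], [Q], [S]. *)
Definition heron (P Q S : R) : R :=
  2 * (P * Q + Q * S + P * S) - P ^ 2 - Q ^ 2 - S ^ 2.

(** This is [gram4] with the circumcenter as fourth vector. In half gaps [P], [Q], [S] the Gram
    determinant of the vertices is [4 * (heron P Q S + 4 * P * Q * S)], and the coefficient of
    [C ^ 2] is [4 * heron P Q S]. *)
Lemma circumcircle_heron o a b c C :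
  lor o a = C -> lor o b = C -> lor o c = C ->
  (C ^ 2 - 1) * heron (half_gap a b) (half_gap a c) (half_gap b c)
  = 4 * half_gap a b * half_gap a c * half_gap b c.
Proof.
  intros Ea Eb Ec.
  pose proof (gram4 (emb a) (emb b) (emb c) (emb o)) as G.
  fold (lor o o) (lor a a) (lor b b) (lor c c) (lor a b) (lor a c) (lor b c)
    (lor a o) (lor b o) (lor c o) in G.
  rewrite !lor_refl, (lor_sym a o), (lor_sym b o), (lor_sym c o), Ea, Eb, Ec in G.
  unfold half_gap, heron.
  set (p := lor a b) in *; set (q := lor a c) in *; set (s := lor b c) in *.
  nra.
Qed.

(** The right side is a quadratic form in [(s, t, w)] and the left side its value at [(k, k, k)].
    After shifting by [k], the terms linear in the shift are nonnegative by the two linear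
    hypotheses, and the quadratic ones by the Gram inequality. *)
Lemma separation_form_ge p q r s t w k :
  1 <= p -> 1 <= q -> 1 <= r -> 0 <= k -> k <= s -> k <= t -> k <= w ->
  0 <= q + r - p - 1 -> 0 <= p + r - q - 1 ->
  0 <= 1 + 2 * p * q * r - p ^ 2 - q ^ 2 - r ^ 2 ->
  k ^ 2 * ((p - q) ^ 2 + (r - 1) * (r + 3 + 2 * p + 2 * q)) <=
  s ^ 2 * (r ^ 2 - 1) + t ^ 2 * (q ^ 2 - 1) + w ^ 2 * (p ^ 2 - 1)
  + 2 * s * t * (q * r - p) + 2 * s * w * (p * r - q) - 2 * t * w * (p * q - r).
Proof.
  intros Hp Hq Hr Hk Hs Ht Hw Hc Hb HG.
  set (x := s - k); set (y := t - k); set (z := w - k).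
  replace s with (k + x) by (unfold x; ring).
  replace t with (k + y) by (unfold y; ring).
  replace w with (k + z) by (unfold z; ring).
  assert (Hx : 0 <= x) by (unfold x; lra).
  assert (Hy : 0 <= y) by (unfold y; lra).
  assert (Hz : 0 <= z) by (unfold z; lra).
  clearbody x y z.
  assert (L1 : 0 <= k * x * ((r - 1) * (r + 1 + p + q))).
  { apply Rmult_le_pos; [nra|]; apply Rmult_le_pos; lra. }
  assert (L2 : 0 <= k * y * ((q + 1) * (q + r - p - 1))).
  { apply Rmult_le_pos; [nra|]; apply Rmult_le_pos; lra. }
  assert (L3 : 0 <= k * z * ((p + 1) * (p + r - q - 1))).
  { apply Rmult_le_pos; [nra|]; apply Rmult_le_pos; lra. }
  assert (Q1 : 0 <= x ^ 2 * (r ^ 2 - 1)).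
  { apply Rmult_le_pos; [apply pow2_ge_0 | nra]. }
  assert (Q2 : 0 <= x * y * (q * r - p)).
  { apply Rmult_le_pos; nra. }
  assert (Q3 : 0 <= x * z * (p * r - q)).
  { apply Rmult_le_pos; nra. }
  assert (Q4 : 0 <= y ^ 2 * (q ^ 2 - 1) + z ^ 2 * (p ^ 2 - 1)
                    - 2 * y * z * (p * q - r)).
  { assert (A : 0 <= y ^ 2 * (q ^ 2 - 1)) by (apply Rmult_le_pos; [apply pow2_ge_0 | nra]).
    assert (B : 0 <= z ^ 2 * (p ^ 2 - 1)) by (apply Rmult_le_pos; [apply pow2_ge_0 | nra]).
    set (A' := y ^ 2 * (q ^ 2 - 1)) in *; set (B' := z ^ 2 * (p ^ 2 - 1)) in *.
    assert (E : (y * z * (p * q - r)) ^ 2 <= A' * B').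
    { replace (A' * B') with ((y * z) ^ 2 * ((p ^ 2 - 1) * (q ^ 2 - 1)))
        by (unfold A', B'; ring).
      rewrite Rpow_mult_distr; apply Rmult_le_compat_l; [apply pow2_ge_0 | nra]. }
    pose proof (pow2_ge_0 (A' - B')).
    apply Rnot_lt_le; intros Hn.
    assert (A' + B' < 2 * (y * z * (p * q - r))) by lra.
    nra. }
  nra.
Qed.

(** By [gram4], [- form n n] times the Gram determinant of the vertices is the quadratic form of
    [separation_form_ge] in the three distances from the line. The hypotheses on [P] and [Q] exclude
    obtuse angles opposite these edges in the Euclidean triangle with squared edges [P], [Q],
    [S]. *)
Lemma separated_vertex_bound lam a b c n :
  0 <= lam -> 0 < - form n n ->
  let k := sinh lam * sqrt (- form n n) in
  k <= form n (emb a) -> form n (emb b) <= - k -> form n (emb c) <= - k ->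
  let P := half_gap a b in let Q := half_gap a c in let S := half_gap b c in
  P <= Q + S -> Q <= P + S ->
  sinh lam ^ 2 * (4 * S * (1 + P + Q) - heron P Q S)
  <= heron P Q S + 4 * P * Q * S.
Proof.
  intros Hlam HM k Ha Hb Hc P Q S HP HQ.
  assert (Hk2 : k ^ 2 = sinh lam ^ 2 * - form n n)
    by (unfold k; rewrite Rpow_mult_distr, pow2_sqrt; lra).
  assert (Hk : 0 <= k).
  { apply Rmult_le_pos; [now apply sinh_nonneg | apply sqrt_pos]. }
  pose proof (gram4 (emb a) (emb b) (emb c) n) as G.
  fold (lor a a) (lor b b) (lor c c) (lor a b) (lor a c) (lor b c) in G.
  rewrite !lor_refl, (form_sym (emb a) n), (form_sym (emb b) n),
    (form_sym (emb c) n) in G.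
  pose proof (gram_lor_nonneg a b c) as HG.
  pose proof (lor_ge_1 a b) as Hp; pose proof (lor_ge_1 a c) as Hq;
    pose proof (lor_ge_1 b c) as Hr.
  unfold P, Q, S, half_gap, heron in *; clear P Q S.
  set (p := lor a b) in *; set (q := lor a c) in *; set (r := lor b c) in *.
  set (M := - form n n) in *.
  replace (form n n) with (- M) in G by (unfold M; ring).
  clearbody k p q r M.
  pose proof (separation_form_ge p q r _ _ _ k Hp Hq Hr Hk Ha
    (Ropp_le_cancel _ _ (Rle_trans _ _ _ (Req_le _ _ (Ropp_involutive _)) Hb))
    (Ropp_le_cancel _ _ (Rle_trans _ _ _ (Req_le _ _ (Ropp_involutive _)) Hc))
    ltac:(lra) ltac:(lra) HG) as F.
  rewrite Hk2 in F.
  apply (Rmult_le_reg_l (4 * M)); [lra|].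
  nra.
Qed.

(** * Reduction to isosceles triangles in the same circumcircle *)

Lemma isosceles_reduction_ordered l u P Q S : 0 < l -> 0 < u ->
  0 < P -> 0 < Q -> Q <= S -> u * heron P Q S = 4 * P * Q * S ->
  l * (4 * S * (1 + P + Q) - heron P Q S) <= heron P Q S + 4 * P * Q * S ->
  exists T, Q <= T /\ P <= 2 * T /\ u * (4 * T - P) = 4 * T ^ 2 /\
    (1 + l) * P ^ 2 <= 4 * T * (1 + T) * (P - l).
Proof.
  intros Hl Hu HP HQ HQS E H.
  assert (HQS0 : 0 < Q * S) by nra.
  assert (HPu : P <= u).
  { unfold heron in E.
    assert (0 <= u * (P - Q - S) ^ 2) by (apply Rmult_le_pos; [lra | apply pow2_ge_0]).
    assert (P * (Q * S) <= u * (Q * S)) by nra.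
    now apply (Rmult_le_reg_r (Q * S)). }
  set (D := sqrt (u ^ 2 - u * P)).
  assert (HD0 : 0 <= D) by apply sqrt_pos.
  assert (HD : D ^ 2 = u ^ 2 - u * P) by (apply pow2_sqrt; nra).
  (* The larger root of [4 * T ^ 2 - 4 * u * T + u * P = 0]: the isosceles triangle over the base
     [P] with the longer legs. Its apex maximizes the shorter of the two other edges, whence
     [Q <= T]. *)
  set (T := (u + D) / 2).
  assert (HT : u * (4 * T - P) = 4 * T ^ 2) by (unfold T; nra).
  assert (HuT : u <= 2 * T) by (unfold T; lra).
  assert (HQT : Q <= T).
  { destruct (Rle_lt_dec Q (u / 2)) as [|HQu]; [lra|].
    (* The isosceles triangle with legs [Q] in the same circle has base [4 * Q * (u - Q) / u]; the
       claim is that [P] does not exceed it. *)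
    assert (HPQ : u * P <= 4 * Q * (u - Q)).
    { apply Rnot_lt_le; intros Hn; unfold heron in E.
      (* [f] below, as a quadratic in [v], vanishes at [u * P]; it is
         nonnegative at [4 * Q * (u - Q)], to the right of its vertex *)
      set (f := fun v => v ^ 2 - 2 * v * (u * Q + u * S - 2 * Q * S)
                         + u ^ 2 * (Q - S) ^ 2).
      assert (f0 : f (u * P) = 0).
      { transitivity (u * (4 * P * Q * S - u * heron P Q S));
          [unfold f, heron; ring | rewrite <- E; unfold heron; ring]. }
      set (d := S - Q).
      assert (f1 : f (4 * Q * (u - Q)) = u ^ 2 * d ^ 2 + 8 * Q * (u - Q) * d * (2 * Q - u)).
      { unfold f, d; ring. }
      assert (Hd : 0 <= d) by (unfold d; lra).
      assert (HQu' : Q <= u).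
      { assert (0 <= u * (Q - P - S) ^ 2) by (apply Rmult_le_pos; [lra | apply pow2_ge_0]).
        assert (Q * (P * S) <= u * (P * S)) by nra.
        apply (Rmult_le_reg_r (P * S)); [nra | lra]. }
      assert (0 <= f (4 * Q * (u - Q))).
      { rewrite f1; apply Rplus_le_le_0_compat.
        - apply Rmult_le_pos; apply pow2_ge_0.
        - repeat apply Rmult_le_pos; lra. }
      assert (Hvert : u * Q + u * S - 2 * Q * S <= 2 * Q * (u - Q)).
      { replace S with (Q + d) by (unfold d; ring); nra. }
      assert (f (u * P) - f (4 * Q * (u - Q)) =
        (u * P - 4 * Q * (u - Q)) * (u * P + 4 * Q * (u - Q)
          - 2 * (u * Q + u * S - 2 * Q * S))) by (unfold f; ring).
      assert (0 < u * P + 4 * Q * (u - Q) - 2 * (u * Q + u * S - 2 * Q * S)) by nra.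
      assert (0 < (u * P - 4 * Q * (u - Q)) * (u * P + 4 * Q * (u - Q)
          - 2 * (u * Q + u * S - 2 * Q * S))) by (apply Rmult_lt_0_compat; lra).
      lra. }
    assert ((2 * Q - u) ^ 2 <= D ^ 2) by (rewrite HD; nra).
    unfold T; nra. }
  exists T; repeat split; trivial; [lra|].
  (* The separation inequality multiplied by [u], with [u * heron P Q S] replaced and [4 * S]
     cancelled. *)
  assert (H1 : l * (u * (1 + P + Q)) <= P * Q * (u + 1 + l)).
  { apply (Rmult_le_reg_l (4 * S)); [nra|].
    assert (u * (l * (4 * S * (1 + P + Q) - heron P Q S))
      <= u * (heron P Q S + 4 * P * Q * S)) by (apply Rmult_le_compat_l; lra).
    nra. }
  assert (H2 : 0 < P * (u + 1 + l) - l * u).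
  { assert (0 < l * (u * (1 + P))) by (repeat apply Rmult_lt_0_compat; lra). nra. }
  (* [H1] is linear in [Q], and by [H2] its slope is favorable, so [Q] may be raised to [T].
     Eliminating [u] by [HT] then gives the goal. *)
  assert (H3 : l * (u * (1 + P + T)) <= P * T * (u + 1 + l)) by nra.
  assert (H4 : 0 < 4 * T - P) by lra.
  apply (Rmult_le_compat_l (4 * T - P)) in H3; [|lra].
  apply (Rmult_le_reg_l T); [lra|].
  replace ((4 * T - P) * (l * (u * (1 + P + T))))
    with (l * (1 + P + T) * (4 * T ^ 2)) in H3 by (rewrite <- HT; ring).
  replace ((4 * T - P) * (P * T * (u + 1 + l)))
    with (P * T * (4 * T ^ 2 + (1 + l) * (4 * T - P))) in H3 by (rewrite <- HT; ring).
  lra.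
Qed.

Lemma heron_swap P Q S : heron P S Q = heron P Q S.
Proof. unfold heron; ring. Qed.

(* The isosceles triangle with base [P] in the same circumcircle is also
   separable. *)
Lemma isosceles_reduction l u P Q S m : 0 < l -> 0 < u ->
  0 < P -> 0 < Q -> 0 < S -> m <= Q -> m <= S ->
  u * heron P Q S = 4 * P * Q * S ->
  l * (4 * S * (1 + P + Q) - heron P Q S) <= heron P Q S + 4 * P * Q * S ->
  l * (4 * Q * (1 + P + S) - heron P Q S) <= heron P Q S + 4 * P * Q * S ->
  exists T, m <= T /\ P <= 2 * T /\ u * (4 * T - P) = 4 * T ^ 2 /\
    (1 + l) * P ^ 2 <= 4 * T * (1 + T) * (P - l).
Proof.
  intros Hl Hu HP HQ HS HmQ HmS E HA HB.
  destruct (Rle_dec Q S) as [H|H].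
  - destruct (isosceles_reduction_ordered l u P Q S) as (T & ? & HT); trivial.
    exists T; split; trivial; lra.
  - destruct (isosceles_reduction_ordered l u P S Q) as (T & ? & HT);
      rewrite ?(heron_swap P Q S); trivial; try lra.
    exists T; split; trivial; lra.
Qed.

(** * Minimizing the circumradius over separable isosceles triangles *)

(** Solves [u * heron Y T T = 4 * Y * T * T] for [u]: base [Y] and legs [T], all measured by
    [sinh ^ 2] of the half lengths. *)
Definition sq_circumradius (T Y : R) : R := 4 * T ^ 2 / (4 * T - Y).

Lemma sq_circumradius_le_base T Y Y' : Y' <= Y -> Y < 4 * T ->
  sq_circumradius T Y' <= sq_circumradius T Y.
Proof.
  intros; unfold sq_circumradius, Rdiv.
  apply Rmult_le_compat_l; [nra|]; apply Rinv_le_contravar; lra.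
Qed.

Lemma sq_circumradius_le_leg T T' Y : 0 < Y -> Y <= 2 * T' -> T' <= T ->
  sq_circumradius T' Y <= sq_circumradius T Y.
Proof.
  intros; apply Rminus_le_0; unfold sq_circumradius.
  replace (_ - _) with (4 * (T - T') * (4 * T * T' - Y * (T + T'))
    / ((4 * T - Y) * (4 * T' - Y))) by (field; lra).
  apply Rdiv_le_0_compat.
  - apply Rmult_le_pos; nra.
  - apply Rmult_lt_0_compat; lra.
Qed.

(* The least admissible [sinh^2 x] over a base with [sinh^2 y = Y]. *)
Definition least_leg (l Y : R) : R :=
  (sqrt (1 + (1 + l) * Y ^ 2 / (Y - l)) - 1) / 2.

Lemma least_leg_spec l Y : 0 < l -> l < Y ->
  l <= least_leg l Y /\
  4 * least_leg l Y * (1 + least_leg l Y) * (Y - l) = (1 + l) * Y ^ 2.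
Proof.
  intros Hl HY; unfold least_leg.
  set (m := (1 + l) * Y ^ 2 / (Y - l)).
  assert (Em : m * (Y - l) = (1 + l) * Y ^ 2) by (unfold m; field; lra).
  assert (Hm : 4 * l * (1 + l) <= m).
  { apply (Rmult_le_reg_r (Y - l)); [lra|]; rewrite Em.
    assert (0 <= (1 + l) * (Y - 2 * l) ^ 2)
      by (apply Rmult_le_pos; [lra | apply pow2_ge_0]); nra. }
  clearbody m.
  assert (Hw : sqrt (1 + m) ^ 2 = 1 + m) by (apply pow2_sqrt; nra).
  pose proof (sqrt_pos (1 + m)) as Hw0.
  set (w := sqrt (1 + m)) in *; clearbody w; split.
  - nra.
  - rewrite <- Em; replace m with (w ^ 2 - 1) by lra; field.
Qed.

Lemma least_leg_le l Y T : 0 < l -> l < Y -> 0 <= T ->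
  (1 + l) * Y ^ 2 <= 4 * T * (1 + T) * (Y - l) -> least_leg l Y <= T.
Proof.
  intros Hl HY HT H.
  destruct (least_leg_spec l Y Hl HY) as [L E].
  rewrite <- E in H; apply Rmult_le_reg_r in H; [nra|lra].
Qed.

Lemma least_leg_unique l Y T : 0 < l -> l < Y -> 0 <= T ->
  4 * T * (1 + T) * (Y - l) = (1 + l) * Y ^ 2 -> least_leg l Y = T.
Proof.
  intros Hl HY HT H.
  destruct (least_leg_spec l Y Hl HY) as [L E].
  rewrite <- E in H; apply Rmult_eq_reg_r in H; [nra|lra].
Qed.

Definition iso_sq_circumradius (l Y : R) : R := sq_circumradius (least_leg l Y) Y.

(* Up to a factor that is positive on (l, 2 l], minus the derivative of
   [iso_sq_circumradius l]. *)
Definition crit (l Y : R) : R :=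
  Y ^ 3 - 5 * l * Y ^ 2 + (5 * l ^ 2 - 2 * l) * Y + 3 * l ^ 2.

Lemma is_derive_least_leg l Y : 0 < l -> l < Y ->
  is_derive (least_leg l) Y
    ((1 + l) * Y * (Y - 2 * l) / (4 * (1 + 2 * least_leg l Y) * (Y - l) ^ 2)).
Proof.
  intros Hl HY.
  assert (Hm : 0 < 1 + (1 + l) * Y ^ 2 / (Y - l)).
  { assert (0 <= (1 + l) * Y ^ 2 / (Y - l)); [|lra].
    apply Rdiv_le_0_compat; [nra | lra]. }
  replace (1 + 2 * least_leg l Y) with (sqrt (1 + (1 + l) * Y ^ 2 / (Y - l)))
    by (unfold least_leg; field).
  unfold least_leg; auto_derive.
  - split; [lra|]; split; trivial.
  - pose proof (sqrt_lt_R0 _ Hm) as Hs.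
    replace (Y * (Y * 1)) with (Y ^ 2) by ring.
    replace (Y + - l) with (Y - l) by ring.
    replace ((1 + l) * Y ^ 2 * / (Y - l)) with ((1 + l) * Y ^ 2 / (Y - l)) by reflexivity.
    set (w := sqrt _) in *; clearbody w; field; lra.
Qed.

(** The reciprocal of [iso_sq_circumradius] is differentiated instead, since it is simply
    [1 / S - Y / (4 * S ^ 2)] with [S] the least leg. *)
Definition inv_iso_sq_circumradius (l Y : R) : R :=
  (4 * least_leg l Y - Y) / (4 * least_leg l Y ^ 2).

(** The defining equation of [S] removes its higher powers from the numerator, leaving a positive
    factor times an expression linear in [1 + 2 * S], that is, in the square root occurring in
    [least_leg]. *)
Lemma inv_iso_derive_value l Y S : 0 < l -> l < Y -> l <= S ->
  4 * S * (1 + S) * (Y - l) = (1 + l) * Y ^ 2 ->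
  (1 + l) * Y * (Y - 2 * l) / (4 * (1 + 2 * S) * (Y - l) ^ 2)
    * (Y - 2 * S) / (2 * S ^ 3) - 1 / (4 * S ^ 2)
  = ((Y + 1) * (2 * l - Y) - (1 + 2 * S) * (Y - l))
    * (l / (4 * S ^ 2 * (1 + 2 * S) * (Y - l) ^ 2)).
Proof.
  intros Hl HY HS ES.
  assert (HS2 : 0 < S ^ 2) by (apply pow_lt; lra).
  assert (HY2 : 0 < (Y - l) ^ 2) by (apply pow_lt; lra).
  set (S' := _ / (4 * _ * _)).
  assert (E1 : S' = (Y - 2 * l) * (S * (1 + S)) / ((1 + 2 * S) * Y * (Y - l))).
  { unfold S'; apply (Rmult_eq_reg_r (4 * (1 + 2 * S) * Y * (Y - l) ^ 2));
      [|apply Rgt_not_eq; repeat apply Rmult_lt_0_compat; lra].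
    transitivity ((1 + l) * Y ^ 2 * (Y - 2 * l)); [field; lra|].
    rewrite <- ES; field; lra. }
  assert (E2 : 4 * S * (1 + S) * (Y - l) - Y * (Y - l) = Y * l * (Y + 1))
    by (rewrite ES; ring).
  rewrite E1; apply (Rmult_eq_reg_r (4 * S ^ 2 * (1 + 2 * S) * Y * (Y - l) ^ 2));
    [|apply Rgt_not_eq; repeat apply Rmult_lt_0_compat; lra].
  transitivity ((Y - l) * (2 * (Y - 2 * l) * (1 + S) * (Y - 2 * S)
    - (1 + 2 * S) * Y * (Y - l))); [field; lra|].
  transitivity (Y * l * ((Y + 1) * (2 * l - Y) - (1 + 2 * S) * (Y - l)));
    [|field; lra].
  transitivity ((4 * S * (1 + S) * (Y - l) - Y * (Y - l)) * (2 * l - Y)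
    - (1 + 2 * S) * Y * l * (Y - l)); [ring|].
  rewrite E2; ring.
Qed.

Lemma inv_iso_derive_sign l Y : 0 < l -> l < Y -> Y <= 2 * l -> exists d,
  is_derive (inv_iso_sq_circumradius l) Y d /\
  (0 <= crit l Y -> 0 <= d) /\ (crit l Y <= 0 -> d <= 0).
Proof.
  intros Hl HY HY2.
  pose proof (is_derive_least_leg l Y Hl HY) as DS.
  destruct (least_leg_spec l Y Hl HY) as [HS ES].
  set (S := least_leg l Y) in *.
  set (S' := (1 + l) * Y * (Y - 2 * l) / (4 * (1 + 2 * S) * (Y - l) ^ 2)) in *.
  exists (S' * (Y - 2 * S) / (2 * S ^ 3) - 1 / (4 * S ^ 2)); split.
  - unfold inv_iso_sq_circumradius; auto_derive; fold S.
    + repeat split; try (now exists S'); apply Rgt_not_eq; nra.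
    + replace (Derive (fun x : R => least_leg l x) Y) with S'
        by (symmetry; now apply is_derive_unique).
      field; lra.
  - set (J := (Y + 1) * (2 * l - Y) - (1 + 2 * S) * (Y - l)).
    assert (EJ : S' * (Y - 2 * S) / (2 * S ^ 3) - 1 / (4 * S ^ 2)
      = J * (l / (4 * S ^ 2 * (1 + 2 * S) * (Y - l) ^ 2)))
      by (now apply inv_iso_derive_value).
    assert (Hf : 0 < l / (4 * S ^ 2 * (1 + 2 * S) * (Y - l) ^ 2)).
    { clearbody S; apply Rdiv_lt_0_compat; [lra|].
      repeat apply Rmult_lt_0_compat; try apply pow_lt; lra. }
    (* Multiplying [J] by its conjugate removes the square root [1 + 2 * S] and leaves the cubic;
       the conjugate is positive on [(l, 2 l]]. *)
    assert (EC : (Y + 1) * crit l Y = J * ((Y + 1) * (2 * l - Y) + (1 + 2 * S) * (Y - l))).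
    { transitivity (((Y + 1) * (2 * l - Y)) ^ 2
        - ((Y - l) + 4 * S * (1 + S) * (Y - l)) * (Y - l));
        [rewrite ES; unfold crit; ring | unfold J; ring]. }
    assert (HP : 0 < (Y + 1) * (2 * l - Y) + (1 + 2 * S) * (Y - l)).
    { assert (0 <= (Y + 1) * (2 * l - Y)) by (apply Rmult_le_pos; lra).
      assert (0 < (1 + 2 * S) * (Y - l)) by (apply Rmult_lt_0_compat; lra). lra. }
    set (F := l / _) in *; set (G := (Y + 1) * (2 * l - Y) + _) in *.
    rewrite EJ; clearbody J F G; split; intros.
    + apply Rmult_le_pos; [|lra].
      apply (Rmult_le_reg_r G); trivial; rewrite <- EC; nra.
    + assert (J <= 0); [|nra].
      apply (Rmult_le_reg_r G); trivial; rewrite <- EC; nra.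
Qed.

Lemma inv_iso_pos l Y : 0 < l -> l < Y -> Y <= 2 * l ->
  0 < inv_iso_sq_circumradius l Y /\
  iso_sq_circumradius l Y = / inv_iso_sq_circumradius l Y.
Proof.
  intros Hl HY HY2; destruct (least_leg_spec l Y Hl HY) as [HS _].
  unfold inv_iso_sq_circumradius, iso_sq_circumradius, sq_circumradius; split.
  - apply Rdiv_lt_0_compat; nra.
  - field; lra.
Qed.

Lemma inv_iso_MVT l Y Z : 0 < l -> l < Y -> Y < Z -> Z <= 2 * l ->
  exists c d, Y <= c <= Z /\ (0 <= crit l c -> 0 <= d) /\ (crit l c <= 0 -> d <= 0)
  /\ inv_iso_sq_circumradius l Z - inv_iso_sq_circumradius l Y = d * (Z - Y).
Proof.
  intros Hl HY HYZ HZ.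
  destruct (MVT_gen (inv_iso_sq_circumradius l) Y Z
    (Derive (inv_iso_sq_circumradius l))) as (c & Hc & E).
  - rewrite Rmin_left, Rmax_right by lra; intros x Hx.
    destruct (inv_iso_derive_sign l x) as (d & D & _); try lra.
    apply Derive_correct; now exists d.
  - rewrite Rmin_left, Rmax_right by lra; intros x Hx.
    destruct (inv_iso_derive_sign l x) as (d & D & _); try lra.
    apply derivable_continuous_pt; exists d; now apply is_derive_Reals.
  - rewrite Rmin_left, Rmax_right in Hc by lra.
    destruct (inv_iso_derive_sign l c) as (d & D & D1 & D2); try lra.
    rewrite (is_derive_unique _ _ _ D) in E.
    exists c, d; auto.
Qed.

Lemma crit_decreasing l Y Z : 0 < l -> l <= Y -> Y <= Z -> Z <= 2 * l ->
  crit l Z <= crit l Y.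
Proof.
  intros Hl HY HYZ HZ.
  assert (0 <= (Z - Y) * (- (Y ^ 2 + Y * Z + Z ^ 2 - 5 * l * (Y + Z)
    + 5 * l ^ 2 - 2 * l))).
  { apply Rmult_le_pos; [lra|].
    assert (0 <= (Y - l) * (2 * l - Y)) by (apply Rmult_le_pos; lra).
    assert (0 <= (Z - l) * (2 * l - Z)) by (apply Rmult_le_pos; lra).
    assert (0 <= (Y - l) * (2 * l - Z)) by (apply Rmult_le_pos; lra).
    nra. }
  unfold crit; nra.
Qed.

Lemma iso_sq_circumradius_left l Y Z M : 0 < l -> l < Y -> Y <= Z -> Z <= M ->
  M <= 2 * l -> crit l M = 0 ->
  iso_sq_circumradius l Z <= iso_sq_circumradius l Y.
Proof.
  intros Hl HY [HYZ | ->] HZ HM E; [|lra].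
  destruct (inv_iso_MVT l Y Z) as (c & d & Hc & D & _ & H); try lra.
  destruct (inv_iso_pos l Y) as [PY ->]; try lra.
  destruct (inv_iso_pos l Z) as [PZ ->]; try lra.
  apply Rinv_le_contravar; trivial.
  assert (0 <= d); [|nra].
  apply D; rewrite <- E; apply crit_decreasing; lra.
Qed.

Lemma iso_sq_circumradius_right l Y M : 0 < l -> l < M -> M <= Y -> Y <= 2 * l ->
  crit l M = 0 -> iso_sq_circumradius l M <= iso_sq_circumradius l Y.
Proof.
  intros Hl HM [HY | ->] HY2 E; [|lra].
  destruct (inv_iso_MVT l M Y) as (c & d & Hc & _ & D & H); try lra.
  destruct (inv_iso_pos l Y) as [PY ->]; try lra.
  destruct (inv_iso_pos l M) as [PM ->]; try lra.
  apply Rinv_le_contravar; trivial.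
  assert (d <= 0); [|nra].
  apply D; rewrite <- E; apply crit_decreasing; lra.
Qed.

(** Here the base is at most twice the leg, so the squared [sinh] of the circumradius is at most
    twice the leg. This serves the comparison with obtuse triangles. *)
Lemma iso_sq_circumradius_le_leg l Y m : 0 < l -> l < Y -> Y <= 2 * l ->
  least_leg l Y <= m -> iso_sq_circumradius l Y <= 2 * m.
Proof.
  intros Hl HY HY2 Hm; destruct (least_leg_spec l Y Hl HY) as [HS _].
  unfold iso_sq_circumradius, sq_circumradius.
  set (S := least_leg l Y) in *; clearbody S.
  apply Rle_trans with (2 * S); [|lra].
  apply Rminus_le_0.
  replace (_ - _) with (2 * S * (2 * S - Y) / (4 * S - Y)) by (field; lra).
  apply Rdiv_le_0_compat; nra.
Qed.

Lemma least_leg_double l : 0 < l -> least_leg l (2 * l) = l.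
Proof. intros; apply least_leg_unique; nra. Qed.

(** [Z] is the base of the extremal triangle. Bases up to [Z] are handled by monotonicity left of
    [M]. For larger [Y], either [Z = M] minimizes on [(l, 2 l]], or the legs, being at least [m],
    reach [least_leg l Z], and shrinking the base and the legs lowers the circumradius. *)
Lemma isosceles_bound l m Z M T Y : 0 < l -> l <= m -> l < Z -> Z <= M ->
  M <= 2 * l -> crit l M = 0 -> Z = M \/ least_leg l Z <= m ->
  0 < Y -> Y <= 2 * T -> m <= T ->
  (1 + l) * Y ^ 2 <= 4 * T * (1 + T) * (Y - l) ->
  iso_sq_circumradius l Z <= sq_circumradius T Y.
Proof.
  intros Hl Hm HZ HZM HM E HZm HY HYT HmT H.
  assert (HlY : l < Y).
  { apply Rnot_le_lt; intros Hn.
    assert (0 < (1 + l) * Y ^ 2) by (apply Rmult_lt_0_compat; nra).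
    assert (0 <= 4 * T * (1 + T) * (l - Y)) by (apply Rmult_le_pos; nra).
    lra. }
  pose proof (least_leg_le l Y T Hl HlY ltac:(lra) H) as HT.
  assert (HisoY : Y <= 2 * l -> iso_sq_circumradius l Y <= sq_circumradius T Y).
  { intros HY2; apply sq_circumradius_le_leg; trivial.
    destruct (least_leg_spec l Y Hl HlY); lra. }
  destruct (Rle_dec Y Z) as [HYZ | HYZ].
  - apply Rle_trans with (iso_sq_circumradius l Y); [|apply HisoY; lra].
    now apply (iso_sq_circumradius_left l Y Z M).
  - destruct HZm as [-> | HZm].
    + destruct (Rle_dec Y (2 * l)) as [HY2 | HY2].
      * apply Rle_trans with (iso_sq_circumradius l Y); [|now apply HisoY].
        apply iso_sq_circumradius_right; lra.
      (* Past [2 * l] the comparison runs through the base [2 * l], whose least leg is [l <= T]. *)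
      * apply Rle_trans with (iso_sq_circumradius l (2 * l));
          [apply iso_sq_circumradius_right; lra|].
        unfold iso_sq_circumradius; rewrite least_leg_double by trivial.
        apply Rle_trans with (sq_circumradius T (2 * l));
          [apply sq_circumradius_le_leg | apply sq_circumradius_le_base]; lra.
    + destruct (least_leg_spec l Z Hl HZ).
      apply Rle_trans with (sq_circumradius T Z);
          [apply sq_circumradius_le_leg | apply sq_circumradius_le_base]; lra.
Qed.

(** * Lower bounds for the circumradius of three cocircular centers *)

Definition isolated (lam : R) (a b c : hplane) : Prop := exists n,
  0 < - form n n /\
  let k := sinh lam * sqrt (- form n n) in
  k <= form n (emb a) /\ form n (emb b) <= - k /\ form n (emb c) <= - k.

Lemma isolated_sym lam a b c : isolated lam a b c -> isolated lam a c b.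
Proof. intros (n & H0 & H1 & H2 & H3); now exists n. Qed.

Lemma separated_pair_isolated lam X a b c : 0 < lam -> totally_separable lam X ->
  X a -> X b -> X c -> a <> b -> isolated lam a b c \/ isolated lam b a c.
Proof.
  intros Hlam HX Ha Hb Hc Hab.
  destruct (separating_normal lam X a b c) as (n & H0 & H1 & H2 & [H3 | H3]); trivial.
  - right; exists (comb (-1) n 0 n).
    rewrite !form_comb_l, !form_comb_r.
    replace (-1 * (-1 * form n n + 0 * form n n) + 0 * (-1 * form n n + 0 * form n n))
      with (form n n) by ring.
    split; trivial; lra.
  - left; exists n; auto.
Qed.

(** The edge between the isolated vertices [a] and [b] becomes the base: the separation inequality
    holds at both of its ends, so it is available at the end of the shorter leg, whichever that
    is. *)
Lemma doubly_isolated_bound lam a b c o m Z M :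
  let l := sinh lam ^ 2 in
  0 < lam -> a <> b -> a <> c -> b <> c -> isolated lam a b c -> isolated lam b a c ->
  lor o a = lor o b -> lor o a = lor o c -> l <= m ->
  m <= half_gap a b -> m <= half_gap a c -> m <= half_gap b c ->
  l < Z -> Z <= M -> M <= 2 * l -> crit l M = 0 -> Z = M \/ least_leg l Z <= m ->
  iso_sq_circumradius l Z <= lor o a ^ 2 - 1.
Proof.
  intros l Hlam Hab Hac Hbc Ia Ib Eb Ec Hm HP HQ HS HZ HZM HM HC HZm.
  assert (Hl : 0 < l) by (apply pow_lt, sinh_pos; trivial).
  pose proof (circumcircle_heron o a b c _ eq_refl (eq_sym Eb) (eq_sym Ec)) as E.
  set (u := lor o a ^ 2 - 1) in *.
  set (P := half_gap a b) in *; set (Q := half_gap a c) in *;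
    set (S := half_gap b c) in *.
  assert (Hu : 0 < u).
  { assert (o <> a \/ o <> b) as [H|H]
      by (destruct (classic (o = a)); [right; congruence | now left]);
      apply lor_gt_1 in H; unfold u; nra. }
  (* In the obtuse case [D > A + B >= 2 * m], and [D <= u] because an edge is at most a diameter;
     [2 * m] already exceeds the bound. *)
  assert (Hobtuse : forall A B D, m <= A -> m <= B -> m <= D -> A + B < D ->
    u * heron A B D = 4 * A * B * D -> iso_sq_circumradius l Z <= u).
  { intros A B D HA HB HD HABD E'.
    assert (HDu : D <= u).
    { assert (0 < A * B) by nra.
      assert (0 <= u * (D - A - B) ^ 2) by (apply Rmult_le_pos; [lra | apply pow2_ge_0]).
      apply (Rmult_le_reg_r (A * B)); trivial; unfold heron in E'; nra. }
    apply Rle_trans with (2 * m); [|lra].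
    destruct HZm as [-> | HZm].
    - apply Rle_trans with (iso_sq_circumradius l (2 * l));
        [apply iso_sq_circumradius_right; lra|].
      apply iso_sq_circumradius_le_leg; try lra.
      rewrite least_leg_double; lra.
    - apply iso_sq_circumradius_le_leg; lra. }
  destruct (Rlt_le_dec (P + Q) S) as [O|A1]; [apply (Hobtuse P Q S); trivial|].
  destruct (Rlt_le_dec (P + S) Q) as [O|A2].
  { apply (Hobtuse P S Q); trivial; rewrite heron_swap; lra. }
  destruct (Rlt_le_dec (Q + S) P) as [O|A3].
  { apply (Hobtuse Q S P); trivial.
    replace (heron Q S P) with (heron P Q S) by (unfold heron; ring); lra. }
  clear Hobtuse.
  destruct Ia as (n & Hn & N1 & N2 & N3).
  destruct Ib as (n' & Hn' & N1' & N2' & N3').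
  pose proof (separated_vertex_bound lam a b c n (Rlt_le _ _ Hlam) Hn N1 N2 N3 A3
    ltac:(fold P Q S; lra)) as BA.
  pose proof (separated_vertex_bound lam b a c n' (Rlt_le _ _ Hlam) Hn' N1' N2' N3') as BB.
  rewrite (half_gap_sym b a) in BB; fold l P Q S in BA, BB.
  specialize (BB ltac:(lra) ltac:(lra)).
  rewrite (heron_swap P Q S) in BB.
  destruct (isosceles_reduction l u P Q S m) as (T & HmT & HPT & ET & HT); try lra.
  replace u with (sq_circumradius T P).
  - apply (isosceles_bound l m Z M T P); trivial; lra.
  - unfold sq_circumradius; rewrite <- ET; field; lra.
Qed.

(** Separating [a] from [b] isolates one of them; separating the other two vertices isolates a
    second one. *)
Lemma cocircular_bound lam X o a b c m Z M :
  let l := sinh lam ^ 2 in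
  0 < lam -> totally_separable lam X -> X a -> X b -> X c ->
  a <> b -> a <> c -> b <> c -> lor o a = lor o b -> lor o a = lor o c -> l <= m ->
  (forall x y, X x -> X y -> x <> y -> m <= half_gap x y) ->
  l < Z -> Z <= M -> M <= 2 * l -> crit l M = 0 -> Z = M \/ least_leg l Z <= m ->
  iso_sq_circumradius l Z <= lor o a ^ 2 - 1.
Proof.
  intros l Hlam HX.
  assert (D : forall a b c, X a -> X b -> X c -> a <> b -> a <> c -> b <> c ->
    lor o a = lor o b -> lor o a = lor o c -> l <= m ->
    (forall x y, X x -> X y -> x <> y -> m <= half_gap x y) ->
    l < Z -> Z <= M -> M <= 2 * l -> crit l M = 0 -> Z = M \/ least_leg l Z <= m ->
    isolated lam a b c -> iso_sq_circumradius l Z <= lor o a ^ 2 - 1).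
  { clear a b c; intros a b c Ha Hb Hc Hab Hac Hbc Eb Ec; intros.
    destruct (separated_pair_isolated lam X b c a) as [I|I]; trivial;
      apply isolated_sym in I.
    - apply (doubly_isolated_bound lam a b c o m Z M); auto.
    - apply (doubly_isolated_bound lam a c b o m Z M); auto.
      now apply isolated_sym. }
  intros Ha Hb Hc Hab Hac Hbc Eb Ec; intros.
  destruct (separated_pair_isolated lam X a b c) as [I|I]; trivial.
  - now apply (D a b c).
  - rewrite Eb; apply (D b a c); auto; congruence.
Qed.

Lemma admissible_ge lam rho r s : 0 < rho -> 0 <= s ->
  (forall X o a b c, separable_packing lam rho X -> X a -> X b -> X c ->
    a <> b -> a <> c -> b <> c -> lor o a = lor o b -> lor o a = lor o c ->
    sinh s ^ 2 <= lor o a ^ 2 - 1) ->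
  admissible lam rho r -> s <= r.
Proof.
  intros Hrho Hs H (Hr & X & HX & Hcov).
  apply le_epsilon; intros eps Heps.
  destruct (exists_cocircular_triple rho r eps X) as
    (o & a & b & c & Ha & Hb & Hc & Hab & Hac & Hbc & Eb & Ec & Hle); trivial.
  { now destruct HX. }
  specialize (H X o a b c HX Ha Hb Hc Hab Hac Hbc Eb Ec).
  apply cosh_le_inv; [lra|].
  pose proof (cosh_ge_1 s); pose proof (cosh_sqr s); pose proof (lor_ge_1 o a); nra.
Qed.

Lemma separable_half_gap lam rho X : 0 <= rho -> separable_packing lam rho X ->
  forall x y, X x -> X y -> x <> y -> sinh rho ^ 2 <= half_gap x y.
Proof.
  intros Hr [HX _] x y Hx Hy Hxy; unfold half_gap.
  pose proof (packing_lor rho X x y Hr HX Hx Hy Hxy) as H.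
  rewrite cosh_double in H; lra.
Qed.

(** If [S] is the least of the three, then [P + Q - S] is at least [P] and [Q], so [heron P Q S = 4
    * P * Q - (P + Q - S) ^ 2 <= 3 * P * Q]. *)
Lemma regular_bound m u P Q S : 0 < m -> m <= P -> m <= Q -> m <= S -> 0 < u ->
  u * heron P Q S = 4 * P * Q * S -> 4 * m / 3 <= u.
Proof.
  assert (D : forall P Q S, 0 < m -> m <= S -> S <= P -> S <= Q -> 0 < u ->
    u * heron P Q S = 4 * P * Q * S -> 4 * m / 3 <= u).
  { clear P Q S; intros P Q S Hm HS HP HQ Hu E.
    assert (heron P Q S <= 3 * (P * Q)).
    { assert (P * Q <= (P + Q - S) ^ 2) by nra; unfold heron; lra. }
    assert (0 < P * Q) by nra.
    assert (u * heron P Q S <= u * (3 * (P * Q))) by (apply Rmult_le_compat_l; lra).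
    apply (Rmult_le_reg_r (3 * (P * Q))); [lra|]; nra. }
  intros Hm HP HQ HS Hu E.
  destruct (Rle_dec S P) as [H1|H1], (Rle_dec S Q) as [H2|H2], (Rle_dec P Q) as [H3|H3];
    solve [ apply (D P Q S); lra
          | apply (D Q S P); unfold heron in *; lra
          | apply (D P S Q); unfold heron in *; lra ].
Qed.

(** * The circumradius of a congruence class of isosceles triangles *)

Lemma isosceles_circumradius_unique x y W r : 0 < x -> 0 < y ->
  sinh y ^ 2 < 4 * sinh x ^ 2 ->
  triangle_with_edges (2 * y) (2 * x) (2 * x) W -> circumradius W r ->
  0 <= r /\ sinh r ^ 2 = sq_circumradius (sinh x ^ 2) (sinh y ^ 2).
Proof.
  intros Hx Hy Hxy (a & b & c & HW & Eab & Ebc & Eca) [o Ho].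
  assert (Oa : hdist o a = r) by (apply Ho, HW; now left).
  assert (Ob : hdist o b = r) by (apply Ho, HW; right; now left).
  assert (Oc : hdist o c = r) by (apply Ho, HW; right; now right).
  split; [rewrite <- Oa; apply hdist_nonneg|].
  assert (L : forall p q d, hdist p q = d -> lor p q = cosh d)
    by (intros p q d <-; now rewrite cosh_hdist).
  apply L in Oa, Ob, Oc, Eab, Ebc, Eca.
  rewrite lor_sym in Eca.
  pose proof (circumcircle_heron o a b c _ Oa Ob Oc) as E.
  rewrite (half_gap_sinh a b y), (half_gap_sinh b c x), (half_gap_sinh a c x) in E
    by trivial.
  assert (Hy2 : 0 < sinh y ^ 2) by (apply pow_lt, sinh_pos; trivial).
  rewrite cosh_sqr in E; unfold heron in E; unfold sq_circumradius.
  set (Y := sinh y ^ 2) in *; set (S := sinh x ^ 2) in *; clearbody Y S.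
  apply (Rmult_eq_reg_r (Y * (4 * S - Y))); [|apply Rgt_not_eq; nra].
  transitivity (4 * Y * S * S); [rewrite <- E; ring | field; lra].
Qed.

Lemma isosceles_exists x y : 0 < x -> 0 < y -> sinh y ^ 2 < 4 * sinh x ^ 2 ->
  exists W r, triangle_with_edges (2 * y) (2 * x) (2 * x) W /\ circumradius W r.
Proof.
  intros Hx Hy Hxy.
  assert (Hy2 : 0 < sinh y ^ 2) by (apply pow_lt, sinh_pos; trivial).
  assert (Hx2 : 0 < sinh x ^ 2) by (apply pow_lt, sinh_pos; trivial).
  set (Y := sinh y ^ 2) in *; set (S := sinh x ^ 2) in *.
  set (u := sq_circumradius S Y).
  assert (Eu : u * (4 * S - Y) = 4 * S ^ 2) by (unfold u, sq_circumradius; field; lra).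
  assert (Hu : 0 < u) by (apply Rdiv_lt_0_compat; nra).
  clearbody u.
  assert (Y <= u).
  { assert (0 <= (Y - 2 * S) ^ 2) by apply pow2_ge_0; nra. }
  (* The triangle is inscribed in a circle about the origin with apex [(s, 0)] and base vertices
     [(k / s, g / s)] and [(k / s, - (g / s))]: [g / s] squares to [Y], and [1 + u - k = 1 + 2 * S]
     is the required [lor] along a leg. *)
  set (k := u - 2 * S); set (g := sqrt (u * Y)).
  assert (Hg : g ^ 2 = u * Y) by (apply pow2_sqrt; nra).
  assert (Hkg : k ^ 2 + g ^ 2 = u ^ 2) by (rewrite Hg; unfold k; nra).
  set (s := sqrt u).
  assert (Hs : s ^ 2 = u) by (apply pow2_sqrt; lra).
  assert (Hs0 : 0 < s) by (apply sqrt_lt_R0; lra).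
  set (w := sqrt (1 + u)).
  assert (Hw : w ^ 2 = 1 + u) by (apply pow2_sqrt; lra).
  set (a := (k / s, g / s)); set (b := (k / s, - (g / s))); set (c := (s, 0)).
  assert (Ekg : (k / s) ^ 2 + (g / s) ^ 2 = u).
  { transitivity ((k ^ 2 + g ^ 2) / s ^ 2); [field; lra|].
    rewrite Hkg, Hs; field; lra. }
  assert (Ta : time a = w).
  { unfold time, w, a; cbn [fst snd]; f_equal; lra. }
  assert (Tb : time b = w).
  { unfold time, w, b; cbn [fst snd]; f_equal.
    replace ((- (g / s)) ^ 2) with ((g / s) ^ 2) by ring; lra. }
  assert (Tc : time c = w).
  { unfold time, w, c; cbn [fst snd]; f_equal; rewrite Hs; ring. }
  assert (T0 : time (0, 0) = 1).
  { unfold time; cbn [fst snd]; replace (1 + 0 ^ 2 + 0 ^ 2) with 1 by ring; apply sqrt_1. }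
  exists (triple a b c), (arccosh w); split.
  - exists a, b, c; repeat split; trivial; apply hdist_eq; try lra;
      unfold lor, form, emb; rewrite ?Ta, ?Tb, ?Tc, cosh_double;
      fold Y S; unfold a, b, c; cbn [fst snd].
    + assert ((g / s) ^ 2 = Y) as E.
      { unfold Rdiv; rewrite Rpow_mult_distr, Hg, <- Hs; field; lra. }
      nra.
    + replace (k / s * s) with k by (field; lra); unfold k; lra.
    + replace (s * (k / s)) with k by (field; lra); unfold k; lra.
  - exists (0, 0); intros v Hv; rewrite hdist_lor; f_equal.
    unfold lor, form, emb; cbn [fst snd]; rewrite T0.
    destruct Hv as [-> | [-> | ->]]; rewrite ?Ta, ?Tb, ?Tc; ring.
Qed.

Lemma class_circumradius_isosceles x y : 0 < x -> 0 < y ->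
  sinh y ^ 2 < 4 * sinh x ^ 2 ->
  let T := triangle_with_edges (2 * y) (2 * x) (2 * x) in
  let s := class_circumradius T in
  0 < s /\ sinh s ^ 2 = sq_circumradius (sinh x ^ 2) (sinh y ^ 2) /\
  forall W r, T W -> circumradius W r -> r = s.
Proof.
  intros Hx Hy Hxy T s.
  destruct (isosceles_exists x y Hx Hy Hxy) as (W & r & HW & Hr).
  assert (U : forall W' r', T W' -> circumradius W' r' -> r' = r).
  { intros W' r' HW' Hr'.
    destruct (isosceles_circumradius_unique x y W r Hx Hy Hxy HW Hr) as [P E].
    destruct (isosceles_circumradius_unique x y W' r' Hx Hy Hxy HW' Hr') as [P' E'].
    rewrite <- E in E'.
    apply sinh_nonneg in P, P'.
    apply Rle_antisym; apply sinh_le_inv; nra. }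
  assert (Es : s = r).
  { apply (iota_unique (V := R_CompleteNormedModule)).
    - intros r' (W' & HW' & Hr'); now apply (U W').
    - now exists W. }
  rewrite Es.
  destruct (isosceles_circumradius_unique x y W r Hx Hy Hxy HW Hr) as [P E].
  split; [|split]; trivial.
  destruct P as [|P]; trivial.
  assert (0 < sinh y ^ 2) by (apply pow_lt, sinh_pos; trivial).
  assert (0 < sq_circumradius (sinh x ^ 2) (sinh y ^ 2)).
  { apply Rdiv_lt_0_compat; nra. }
  rewrite <- P, sinh_0 in E; lra.
Qed.

(** * Equality: the circumradius of the tiles is an admissible radius *)

(** The form is negative definite on the orthogonal complement of a time-like vector, so a null
    vector in it vanishes. *)
Lemma null_orthogonal_zero w p : form w w = 0 -> form w (emb p) = 0 ->
  forall v, form w v = 0.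
Proof.
  destruct w as [[x y] t]; unfold form, emb; cbn [fst snd]; intros N O v.
  pose proof (time_sqr p) as E; pose proof (time_pos p).
  set (a := fst p) in *; set (b := snd p) in *; set (s := time p) in *.
  clearbody a b s.
  assert (0 <= (x * b - y * a) ^ 2) by apply pow2_ge_0.
  assert (E1 : t * s = x * a + y * b) by lra.
  assert (E2 : (t * s) ^ 2 + (x * b - y * a) ^ 2 = t ^ 2 * (s ^ 2 - 1)).
  { rewrite E1; replace (t ^ 2) with (x ^ 2 + y ^ 2) by lra.
    rewrite E; ring. }
  assert (t = 0) as ->.
  { apply Rsqr_0_uniq; unfold Rsqr; pose proof (pow2_ge_0 t); nra. }
  assert (x = 0) as -> by (apply Rsqr_0_uniq; unfold Rsqr; pose proof (pow2_ge_0 y); nra).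
  assert (y = 0) as -> by (apply Rsqr_0_uniq; unfold Rsqr; nra).
  ring.
Qed.

(* Equality in the triangle inequality makes
   [sinh B * a + sinh A * b - sinh (A + B) * q] a null vector orthogonal to
   the time-like [q], hence zero. *)
Lemma segment_comb a b q : segment a b q ->
  exists s t, 0 <= s /\ 0 <= t /\ 0 < s + t /\
    forall p, lor q p = s * lor a p + t * lor b p.
Proof.
  unfold segment; intros H.
  pose proof (hdist_nonneg a q) as HA; pose proof (hdist_nonneg q b) as HB.
  pose proof (cosh_hdist a q) as EA; pose proof (cosh_hdist q b) as EB.
  pose proof (cosh_hdist a b) as EAB; rewrite <- H in EAB.
  set (A := hdist a q) in *; set (B := hdist q b) in *; clearbody A B.
  destruct (Req_dec (A + B) 0) as [Z|Z].
  - exists 1, 0; repeat split; try lra.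
    assert (a = q) as ->; [|intros; ring].
    apply lor_eq_1; rewrite <- EA; replace A with 0 by lra; apply cosh_0.
  - assert (0 < sinh (A + B)) by (apply sinh_pos; lra).
    pose proof (sinh_nonneg A HA); pose proof (sinh_nonneg B HB).
    set (w := comb 1 (comb (sinh B) (emb a) (sinh A) (emb b)) (- sinh (A + B)) (emb q)).
    assert (W : forall v, form w v = sinh B * form (emb a) v + sinh A * form (emb b) v
      - sinh (A + B) * form (emb q) v).
    { intros v; unfold w; rewrite !form_comb_l; ring. }
    assert (Wq : form w (emb q) = 0).
    { rewrite W; fold (lor a q) (lor b q) (lor q q).
      rewrite lor_refl, (lor_sym b q), <- EA, <- EB, sinh_plus; ring. }
    assert (W0 : form w w = 0).
    { transitivity (sinh B * form w (emb a) + sinh A * form w (emb b)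
        - sinh (A + B) * form w (emb q)).
      { rewrite W, !(form_sym _ w); reflexivity. }
      rewrite Wq, !W.
      fold (lor a a) (lor b a) (lor q a) (lor a b) (lor b b) (lor q b).
      rewrite !lor_refl, (lor_sym b a), (lor_sym q a), <- EA, <- EB, <- EAB.
      rewrite cosh_plus, sinh_plus.
      pose proof (cosh_sqr A) as CA; pose proof (cosh_sqr B) as CB.
      transitivity (sinh B ^ 2 * (1 + sinh A ^ 2 - cosh A ^ 2)
        + sinh A ^ 2 * (1 + sinh B ^ 2 - cosh B ^ 2)); [ring|].
      rewrite CA, CB; ring. }
    exists (sinh B / sinh (A + B)), (sinh A / sinh (A + B)); split; [|split; [|split]].
    + now apply Rdiv_le_0_compat.
    + now apply Rdiv_le_0_compat.
    + rewrite <- Rdiv_plus_distr; apply Rdiv_lt_0_compat; trivial.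
      destruct (Req_dec A 0) as [A0|A0].
      * assert (0 < sinh B) by (apply sinh_pos; lra); lra.
      * assert (0 < sinh A) by (apply sinh_pos; lra); lra.
    + intros p.
      pose proof (null_orthogonal_zero w q W0 Wq (emb p)) as N; rewrite W in N.
      fold (lor a p) (lor b p) (lor q p) in N.
      apply (Rmult_eq_reg_l (sinh (A + B))); [|lra].
      field_simplify; lra.
Qed.

(** Both sides are linear in [v], and a point of a segment is a nonnegative combination of its
    ends. *)
Lemma closer_convex o p : convex (fun v => lor v o < lor v p).
Proof.
  intros a b Ha Hb q Hq.
  destruct (segment_comb a b q Hq) as (s & t & Hs & Ht & Hst & E).
  rewrite !E; destruct Hs as [Hs | <-]; nra.
Qed.

(* Otherwise all vertices lie in the open half plane of the points closer to
   [o] than to [p], and so does [p]. *)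
Lemma conv_circumdisk V o r p : (forall v, V v -> hdist o v = r) -> conv V p ->
  exists v, V v /\ hdist v p <= r.
Proof.
  intros Ho Hp; apply NNPP; intros N.
  assert (H : lor p o < lor p p).
  { apply (Hp _ (closer_convex o p)); intros v Hv.
    rewrite <- !cosh_hdist, (hdist_sym v o), (Ho v Hv).
    apply cosh_lt; [rewrite <- (Ho v Hv); apply hdist_nonneg|].
    apply Rnot_le_lt; intros Hle; apply N; now exists v. }
  rewrite lor_refl in H; pose proof (lor_ge_1 p o); lra.
Qed.

Lemma circumradius_congruent V W r :
  congruent V W -> circumradius V r -> circumradius W r.
Proof.
  intros (f & [Hf _] & HW) [o Ho]; exists (f o); intros v Hv.
  apply HW in Hv; destruct Hv as (p & Hp & <-); rewrite Hf; auto.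
Qed.

Lemma tiling_admissible lam rho T s : 0 < s ->
  (forall W r, T W -> circumradius W r -> r = s) ->
  has_tiling_packing lam rho T -> admissible lam rho s.
Proof.
  intros Hs HT (X & HX & D & HD & (_ & Hplane & _) & HDT); split; trivial.
  exists X; split; trivial; intros p.
  destruct (proj1 (Hplane p) I) as (V & [HDV HV3] & HVp).
  destruct HD as (_ & _ & _ & HD).
  destruct (HD V HDV) as (HVX & o & r & Ho & _).
  destruct (HDT V HDV HV3) as (W & HW & HVW).
  assert (Er : r = s).
  { apply (HT W); trivial; apply (circumradius_congruent V); trivial; now exists o. }
  destruct (conv_circumdisk V o r p Ho HVp) as (v & Hv & Hvp).
  exists v; split; [now apply HVX | unfold disk; lra].
Qed.

Lemma gamma_bound lam rho T s : 0 < s ->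
  (forall r, admissible lam rho r -> s <= r) ->
  (forall W r, T W -> circumradius W r -> r = s) ->
  Rbar_le s (gamma lam rho) /\ (has_tiling_packing lam rho T -> gamma_eq lam rho s).
Proof.
  intros Hs Hlow HT; split.
  - apply (proj2 (Glb_Rbar_correct (admissible lam rho))); intros r Hr; now apply Hlow.
  - intros H; apply tiling_admissible with (s := s) in H; trivial; split; trivial.
    apply is_glb_Rbar_unique; split.
    + intros r Hr; now apply Hlow.
    + intros b Hb; now apply Hb.
Qed.

(** * The functions [xh] and [xh_inv] in terms of [sinh ^ 2] *)

Lemma sq_sinh_lt x y : 0 <= x -> x < y -> sinh x ^ 2 < sinh y ^ 2.
Proof.
  intros Hx Hy; pose proof (sinh_nonneg x Hx); pose proof (sinh_lt x y Hy); nra.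
Qed.

Lemma sq_sinh_lt_inv x y : 0 <= y -> sinh x ^ 2 < sinh y ^ 2 -> x < y.
Proof.
  intros Hy H; apply Rnot_le_lt; intros Hn.
  apply sinh_le in Hn; pose proof (sinh_nonneg y Hy); nra.
Qed.

Lemma sq_sinh_inj x y : 0 <= x -> 0 <= y -> sinh x ^ 2 = sinh y ^ 2 -> x = y.
Proof.
  intros Hx Hy H; destruct (Rtotal_order x y) as [L | [E | L]]; trivial;
    apply sq_sinh_lt in L; trivial; lra.
Qed.

Lemma sq_sinh_arcsinh_sqrt Y : 0 <= Y -> sinh (arcsinh (sqrt Y)) ^ 2 = Y.
Proof. intros H; rewrite sinh_arcsinh; now apply pow2_sqrt. Qed.

(** Squaring the formula for [sinh (2 * xh lam y)] and writing its square as [4 * S * (1 + S)] gives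
    the defining equation of [least_leg]. *)
Lemma sinh_xh lam y : 0 < lam -> lam < y ->
  0 < xh lam y /\ sinh (xh lam y) ^ 2 = least_leg (sinh lam ^ 2) (sinh y ^ 2).
Proof.
  intros Hlam Hy.
  assert (Hl : 0 < sinh lam ^ 2) by (apply pow_lt, sinh_pos; trivial).
  assert (HY : sinh lam ^ 2 < sinh y ^ 2) by (apply sq_sinh_lt; lra).
  assert (Hd : 0 < sqrt (sinh y ^ 2 - sinh lam ^ 2)) by (apply sqrt_lt_R0; lra).
  assert (Ed : sqrt (sinh y ^ 2 - sinh lam ^ 2) ^ 2 = sinh y ^ 2 - sinh lam ^ 2)
    by (apply pow2_sqrt; lra).
  pose proof (cosh_ge_1 lam) as Hc; pose proof (cosh_sqr lam) as Ec.
  assert (E2 : sinh (2 * xh lam y)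
    = cosh lam * sinh y ^ 2 / sqrt (sinh y ^ 2 - sinh lam ^ 2)).
  { unfold xh; rewrite <- Rmult_assoc, Rinv_r, Rmult_1_l by lra; apply sinh_arcsinh. }
  set (d := sqrt _) in *; split.
  - unfold xh; apply Rmult_lt_0_compat; [lra|]; apply arcsinh_pos.
    apply Rdiv_lt_0_compat; trivial; apply Rmult_lt_0_compat; lra.
  - symmetry; apply least_leg_unique; trivial; [apply pow2_ge_0|].
    rewrite <- cosh_sqr.
    transitivity (sinh (2 * xh lam y) ^ 2 * d ^ 2); [rewrite sinh_double, Ed; ring|].
    rewrite E2, <- Ec; field; lra.
Qed.

Lemma H1_interval_sq lam y : 0 < lam ->
  H1_interval lam y <-> 0 <= y /\ sinh lam ^ 2 < sinh y ^ 2 <= 2 * sinh lam ^ 2.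
Proof.
  intros Hlam; unfold H1_interval.
  assert (E : sinh (arcsinh (sqrt 2 * sinh lam)) ^ 2 = 2 * sinh lam ^ 2)
    by (rewrite sinh_arcsinh, Rpow_mult_distr, pow2_sqrt; lra).
  assert (P : 0 < arcsinh (sqrt 2 * sinh lam)).
  { apply arcsinh_pos, Rmult_lt_0_compat; [apply sqrt_lt_R0; lra | now apply sinh_pos]. }
  rewrite <- E; split.
  - intros [H1 H2]; repeat split; [lra | apply sq_sinh_lt; lra |].
    destruct H2 as [H2 | <-]; [|lra]; left; apply sq_sinh_lt; lra.
  - intros (H0 & H1 & H2); split; [now apply sq_sinh_lt_inv|].
    apply Rnot_lt_le; intros H; apply sq_sinh_lt in H; lra.
Qed.

(** The quotient [Y ^ 2 / (Y - l)] decreases strictly up to [2 * l]. *)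
Lemma least_leg_decreasing l Y Y' : 0 < l -> l < Y -> Y < Y' -> Y' <= 2 * l ->
  least_leg l Y' < least_leg l Y.
Proof.
  intros Hl HY HYY HY'.
  destruct (least_leg_spec l Y Hl HY) as [HS ES].
  destruct (least_leg_spec l Y' Hl ltac:(lra)) as [HS' ES'].
  set (S := least_leg l Y) in *; set (S' := least_leg l Y') in *; clearbody S S'.
  assert (H : Y' ^ 2 * (Y - l) < Y ^ 2 * (Y' - l)).
  { assert (0 < (Y' - Y) * (l * (Y + Y') - Y * Y')) by (apply Rmult_lt_0_compat; nra).
    nra. }
  apply Rnot_le_lt; intros Hn.
  assert (4 * S * (1 + S) <= 4 * S' * (1 + S')) by nra.
  assert (4 * S * (1 + S) * (Y - l) * (Y' - l) <= 4 * S' * (1 + S') * (Y' - l) * (Y - l)).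
  { replace (4 * S' * (1 + S') * (Y' - l) * (Y - l))
      with (4 * S' * (1 + S') * (Y - l) * (Y' - l)) by ring.
    repeat (apply Rmult_le_compat_r; [lra|]); trivial. }
  rewrite ES, ES' in *; nra.
Qed.

Lemma least_leg_surj l m : 0 < l -> l <= m ->
  exists Y, l < Y <= 2 * l /\ least_leg l Y = m.
Proof.
  intros Hl Hm.
  set (W := 4 * m * (1 + m)).
  assert (HW : 4 * l * (1 + l) <= W) by (unfold W; nra).
  set (D := sqrt (W * (W - 4 * l * (1 + l)))).
  assert (D0 : 0 <= D) by apply sqrt_pos.
  assert (ED : D ^ 2 = W * (W - 4 * l * (1 + l))) by (apply pow2_sqrt; nra).
  (* The smaller root of [(1 + l) * Y ^ 2 - W * Y + W * l = 0], which is the one in [(l, 2 l]]. *)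
  set (Y := (W - D) / (2 * (1 + l))).
  assert (EY : Y * (2 * (1 + l)) = W - D) by (unfold Y; field; lra).
  assert (HY : l < Y).
  { apply (Rmult_lt_reg_r (2 * (1 + l))); [lra|]; rewrite EY.
    assert (0 < l * (1 + l)) by nra.
    apply Rnot_le_lt; intros Hn.
    assert ((W - 2 * l * (1 + l)) ^ 2 <= D ^ 2) by (apply pow_incr; lra).
    assert (0 < (l * (1 + l)) ^ 2) by (apply pow_lt; lra).
    nra. }
  exists Y; repeat split; trivial.
  - apply (Rmult_le_reg_r (2 * (1 + l))); [lra|]; rewrite EY.
    apply Rnot_lt_le; intros Hn.
    assert (0 < l * (1 + l)) by nra.
    nra.
  - apply least_leg_unique; try lra; fold W.
    apply (Rmult_eq_reg_r (4 * (1 + l))); [|lra].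
    transitivity (2 * W * (Y * (2 * (1 + l))) - 4 * l * (1 + l) * W); [ring|].
    transitivity ((Y * (2 * (1 + l))) ^ 2); [|ring].
    rewrite EY; nra.
Qed.

Lemma xh_inv_spec lam rho : 0 < lam -> lam <= rho ->
  H1_interval lam (xh_inv lam rho) /\ xh lam (xh_inv lam rho) = rho.
Proof.
  intros Hlam Hrho.
  assert (Hl : 0 < sinh lam ^ 2) by (apply pow_lt, sinh_pos; trivial).
  assert (Hm : sinh lam ^ 2 <= sinh rho ^ 2).
  { destruct Hrho as [H | ->]; [|lra]; left; apply sq_sinh_lt; lra. }
  apply (iota_correct (V := R_CompleteNormedModule)
    (fun y => H1_interval lam y /\ xh lam y = rho)).
  destruct (least_leg_surj _ _ Hl Hm) as (Y & HY & EY).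
  assert (EYs : sinh (arcsinh (sqrt Y)) ^ 2 = Y) by (apply sq_sinh_arcsinh_sqrt; lra).
  assert (P : 0 < arcsinh (sqrt Y)) by (apply arcsinh_pos, sqrt_lt_R0; lra).
  assert (HH : H1_interval lam (arcsinh (sqrt Y)))
    by (apply H1_interval_sq; trivial; rewrite EYs; lra).
  exists (arcsinh (sqrt Y)); split; [split; trivial|].
  - destruct (sinh_xh lam (arcsinh (sqrt Y)) Hlam) as [Px Ex]; [apply HH|].
    rewrite EYs, EY in Ex; apply sq_sinh_inj; lra.
  - intros y [Hy Ey].
    destruct (sinh_xh lam y Hlam) as [Px Ex]; [apply Hy|].
    rewrite Ey in Ex.
    apply H1_interval_sq in Hy; trivial; destruct Hy as [Hy0 Hy].
    apply sq_sinh_inj; try lra; rewrite EYs.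
    destruct (Rtotal_order Y (sinh y ^ 2)) as [L | [E | L]]; trivial;
      apply (least_leg_decreasing (sinh lam ^ 2)) in L; lra.
Qed.

(** * The trigonometric solution of the cubic and [ymin] *)

Lemma cos_triple x : cos (3 * x) = 4 * cos x ^ 3 - 3 * cos x.
Proof.
  replace (3 * x) with (2 * x + x) by ring.
  rewrite cos_plus, sin_2a, cos_2a_cos.
  pose proof (sin2_cos2 x) as H; unfold Rsqr in H.
  transitivity ((2 * cos x * cos x - 1) * cos x - 2 * cos x * (sin x * sin x)); [ring|].
  replace (sin x * sin x) with (1 - cos x * cos x) by lra; ring.
Qed.

(** With [z = A * cos psi] the cubic becomes the triple-angle formula. The shift by [2 * PI / 3]
    puts [psi] between [- 2 * PI / 3] and [- PI / 3], where [cos] is at most 1/2 in absolute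
    value. *)
Lemma viete_middle_root A q : 0 < A -> -1 <= q <= 1 ->
  let z := A * cos (/ 3 * acos q - 2 * PI / 3) in
  z ^ 3 - 3 / 4 * A ^ 2 * z = A ^ 3 * q / 4 /\ - (A / 2) <= z <= A / 2.
Proof.
  intros HA Hq z.
  set (psi := / 3 * acos q - 2 * PI / 3) in *.
  assert (E : cos (3 * psi) = q).
  { replace (3 * psi) with (acos q - 2 * PI) by (unfold psi; field).
    rewrite cos_minus, cos_2PI, sin_2PI, cos_acos by trivial; ring. }
  rewrite cos_triple in E; split; [unfold z; rewrite <- E; field|].
  pose proof (acos_bound q); pose proof PI_RGT_0.
  assert (H1 : cos (2 * (PI / 3)) <= cos (- psi)) by (apply cos_decr_1; unfold psi; lra).
  assert (H2 : cos (- psi) <= cos (PI / 3)) by (apply cos_decr_1; unfold psi; lra).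
  rewrite cos_neg in H1, H2; rewrite cos_2PI3 in H1; rewrite cos_PI3 in H2.
  unfold z; nra.
Qed.

Lemma ymin_spec lam : 0 < lam ->
  let l := sinh lam ^ 2 in let M := sinh (ymin lam) ^ 2 in
  0 <= ymin lam /\ l < M <= 2 * l /\ crit l M = 0.
Proof.
  intros Hlam l M.
  unfold M, ymin; set (L := sinh lam) in *.
  assert (HL : 0 < L) by now apply sinh_pos.
  assert (Hl : 0 < l) by (apply pow_lt; trivial).
  set (q := _ / (4 * _ * _)).
  set (A := 2 / 3 * sqrt (10 * L ^ 4 + 6 * L ^ 2)).
  assert (HA2 : A ^ 2 = 4 / 9 * (10 * l ^ 2 + 6 * l)).
  { unfold A; rewrite Rpow_mult_distr, pow2_sqrt; unfold l; nra. }
  assert (HA : 0 < A).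
  { apply Rmult_lt_0_compat; [lra|]; apply sqrt_lt_R0.
    replace (10 * L ^ 4 + 6 * L ^ 2) with (10 * l ^ 2 + 6 * l) by (unfold l; ring); nra. }
  set (den := 4 * sqrt 2 * Rpower (5 * L ^ 2 + 3) (3 / 2)) in *.
  assert (Hden2 : den ^ 2 = 32 * (5 * l + 3) ^ 3).
  { unfold den; rewrite !Rpow_mult_distr, pow2_sqrt by lra.
    rewrite <- (Rpower_pow 2 (Rpower _ _)) by apply exp_pos.
    rewrite Rpower_mult; replace (3 / 2 * INR 2) with (INR 3) by (simpl; field).
    rewrite Rpower_pow by (fold l; lra); unfold l; ring. }
  assert (Hden : 0 < den).
  { apply Rmult_lt_0_compat; [|apply exp_pos].
    pose proof (sqrt_lt_R0 2 ltac:(lra)); lra. }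
  assert (Hq0 : 0 <= q).
  { apply Rdiv_le_0_compat; trivial; apply Rmult_le_pos; fold l; lra. }
  assert (Hq2 : q ^ 2 * (32 * (5 * l + 3) ^ 3) = l * (25 * l + 9) ^ 2).
  { rewrite <- Hden2; unfold q; fold l.
    transitivity (L ^ 2 * (25 * l + 9) ^ 2); [field; lra | reflexivity]. }
  assert (H3 : 0 < (5 * l + 3) ^ 3) by (apply pow_lt; lra).
  assert (Hq1 : q <= 1).
  { assert (q ^ 2 * (32 * (5 * l + 3) ^ 3) <= 1 * (32 * (5 * l + 3) ^ 3))
      by (rewrite Hq2; nra).
    assert (q ^ 2 <= 1) by (apply Rmult_le_reg_r in H; lra). nra. }
  (* Both sides are nonnegative; squaring turns the fractional powers in [A] and [q] into
     polynomials. *)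
  assert (HAq : A ^ 3 * q = 4 * (l ^ 2 * (25 * l + 9) / 27)).
  { assert (0 <= A ^ 3 * q) by (apply Rmult_le_pos; [left; now apply pow_lt | trivial]).
    assert (0 < 4 * (l ^ 2 * (25 * l + 9) / 27)).
    { apply Rmult_lt_0_compat; [lra|]; apply Rdiv_lt_0_compat; [|lra].
      apply Rmult_lt_0_compat; [now apply pow_lt | lra]. }
    assert ((A ^ 3 * q) ^ 2 = (4 * (l ^ 2 * (25 * l + 9) / 27)) ^ 2); [|nra].
    transitivity ((A ^ 2) ^ 3 * q ^ 2); [ring|]; rewrite HA2.
    apply (Rmult_eq_reg_r (32 * (5 * l + 3) ^ 3)); [|lra].
    rewrite Rmult_assoc, Hq2; field. }
  destruct (viete_middle_root A q HA ltac:(lra)) as [EZ HZ].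
  fold A; set (z := A * cos _) in *.
  rewrite HAq, HA2 in EZ.
  replace (5 * L ^ 2 / 3) with (5 * l / 3) by reflexivity.
  (* The shift by [5 * l / 3] removes the quadratic term of [crit]. *)
  assert (HC : crit l (5 * l / 3 + z) = 0).
  { transitivity (z ^ 3 - 3 / 4 * (4 / 9 * (10 * l ^ 2 + 6 * l)) * z
      - l ^ 2 * (25 * l + 9) / 27); [unfold crit; field | rewrite EZ; field]. }
  assert (HlA : l / 3 <= A / 2 /\ 2 * l / 3 <= A / 2) by (split; nra).
  (* On [- A / 2, A / 2] the cubic decreases. *)
  assert (mono : forall v, - (A / 2) <= v <= A / 2 ->
    0 <= (v - z) * (crit l (5 * l / 3 + z) - crit l (5 * l / 3 + v))).
  { intros v Hv.
    transitivity ((v - z) ^ 2 * (A ^ 2 * 3 / 4 - (v ^ 2 + v * z + z ^ 2))).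
    - apply Rmult_le_pos; [apply pow2_ge_0 | nra].
    - right; rewrite HA2; unfold crit; field. }
  (* After the shift, [l] and [2 * l] sit at [- (2 * l / 3)] and [l / 3]; [crit] is positive at the
     first and negative at the second. *)
  assert (H1 : l < 5 * l / 3 + z).
  { pose proof (mono (- (2 * l / 3)) ltac:(lra)) as Hm.
    rewrite HC in Hm.
    replace (5 * l / 3 + - (2 * l / 3)) with l in Hm by field.
    assert (crit l l = l ^ 3 + l ^ 2) by (unfold crit; ring).
    assert (0 < l ^ 3) by now apply pow_lt.
    assert (Hc : 0 < crit l l) by nra.
    apply Rnot_le_lt; intros [Hn | Hn]; [|rewrite Hn in HC; lra].
    assert (0 < (- (2 * l / 3) - z) * crit l l) by (apply Rmult_lt_0_compat; lra).
    lra. }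
  assert (H2 : 5 * l / 3 + z <= 2 * l).
  { pose proof (mono (l / 3) ltac:(lra)) as Hm.
    rewrite HC in Hm.
    replace (5 * l / 3 + l / 3) with (2 * l) in Hm by field.
    assert (crit l (2 * l) = - (2 * l ^ 3 + l ^ 2)) by (unfold crit; ring).
    assert (0 < l ^ 3) by now apply pow_lt.
    assert (Hc : crit l (2 * l) < 0) by nra.
    apply Rnot_lt_le; intros Hn.
    assert (0 < (z - l / 3) * - crit l (2 * l)) by (apply Rmult_lt_0_compat; lra).
    lra. }
  rewrite sq_sinh_arcsinh_sqrt by lra; repeat split; trivial.
  left; apply arcsinh_pos, sqrt_lt_R0; lra.
Qed.

(** * The three cases of the bound *)

(** Treats the first two cases together, using [cocircular_bound] with [m], [Z], [M] the squares of
    [sinh] at [rho], [y] and [ymin lam]. *)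
Lemma Th_gamma_bound lam rho y : 0 < lam -> lam <= rho ->
  H1_interval lam y -> y <= ymin lam -> y = ymin lam \/ xh lam y <= rho ->
  Rbar_le (Rh lam y) (gamma lam rho) /\
  (has_tiling_packing lam rho (Th lam y) -> gamma_eq lam rho (Rh lam y)).
Proof.
  intros Hlam Hrho Hy Hymin Hyx.
  destruct (sinh_xh lam y Hlam (proj1 Hy)) as [Px Ex].
  apply H1_interval_sq in Hy; trivial; destruct Hy as [Hy0 [Hy1 Hy2]].
  assert (Hl : 0 < sinh lam ^ 2) by (apply pow_lt, sinh_pos; trivial).
  destruct (ymin_spec lam Hlam) as (Hm0 & Hm & HC).
  destruct (least_leg_spec _ _ Hl Hy1) as [HS _].
  assert (Hyp : 0 < y).
  { destruct Hy0 as [|<-]; trivial; rewrite sinh_0 in Hy1; lra. }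
  destruct (class_circumradius_isosceles (xh lam y) y Px Hyp) as (Ps & Es & Us);
    [rewrite Ex; lra|].
  apply gamma_bound; trivial; fold (Th lam y) in *; fold (Rh lam y) in *.
  intros r; apply admissible_ge; [lra | lra |].
  intros X o a b c HX Ha Hb Hc Hab Hac Hbc Eb Ec.
  rewrite Es, Ex.
  apply (cocircular_bound lam X o a b c (sinh rho ^ 2) _ (sinh (ymin lam) ^ 2));
    trivial; try tauto.
  - apply HX.
  - destruct Hrho as [H | ->]; [left; apply sq_sinh_lt; lra | lra].
  - apply (separable_half_gap lam); trivial; lra.
  - destruct Hymin as [H | <-]; [left; apply sq_sinh_lt; lra | lra].
  - destruct Hyx as [-> | Hyx]; [now left | right].
    rewrite <- Ex; destruct Hyx as [H | ->]; [left; apply sq_sinh_lt; lra | lra].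
Qed.

Theorem theorem7 (lam rho : R) (hlam : 0 <= lam) (hle : lam <= rho)
    (hrho : 0 < rho) :
  (case1 lam rho ->
     Rbar_le (Rh lam (ymin lam)) (gamma lam rho) /\
     (has_tiling_packing lam rho (Th lam (ymin lam)) ->
        gamma_eq lam rho (Rh lam (ymin lam)))) /\
  (case2 lam rho ->
     Rbar_le (Rh lam (xh_inv lam rho)) (gamma lam rho) /\
     (has_tiling_packing lam rho (Th lam (xh_inv lam rho)) ->
        gamma_eq lam rho (Rh lam (xh_inv lam rho)))) /\
  (case3 lam rho ->
     Rbar_le (Rh_reg rho) (gamma lam rho) /\
     (has_tiling_packing lam rho (Th_reg rho) ->
        gamma_eq lam rho (Rh_reg rho))).
Proof.
  assert (Hmin : 0 < lam -> H1_interval lam (ymin lam)).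
  { intros Hlam; apply H1_interval_sq; trivial.
    destruct (ymin_spec lam Hlam) as (H0 & H & _); split; trivial. }
  split; [|split].
  - intros [Hlam _]; apply Th_gamma_bound; auto; lra.
  - intros [Hlam [Hx _]].
    destruct (xh_inv_spec lam rho Hlam hle) as [HI HX].
    apply Th_gamma_bound; trivial; [|right; lra].
    (* If [ymin lam] were smaller than [xh_inv lam rho], monotonicity of [least_leg] would give
       [rho < xh lam (ymin lam)], against [Hx]. *)
    apply Rnot_lt_le; intros Hlt.
    specialize (Hmin Hlam).
    destruct (sinh_xh lam _ Hlam (proj1 HI)) as [P E].
    destruct (sinh_xh lam _ Hlam (proj1 Hmin)) as [P' E'].
    rewrite HX in P, E.
    apply H1_interval_sq in HI, Hmin; trivial.
    apply sq_sinh_lt in Hx; [|lra].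
    apply sq_sinh_lt in Hlt; [|lra].
    apply (least_leg_decreasing (sinh lam ^ 2)) in Hlt; lra.
  - intros _.
    assert (Hm : 0 < sinh rho ^ 2) by (apply pow_lt, sinh_pos; trivial).
    (* The regular triangle is the isosceles one with [x = y = rho]; its [sq_circumradius] is the
       value [4 * m / 3] of [regular_bound]. *)
    destruct (class_circumradius_isosceles rho rho hrho hrho) as (Ps & Es & Us); [lra|].
    apply gamma_bound; trivial; fold (Th_reg rho) in *; fold (Rh_reg rho) in *.
    intros r; apply admissible_ge; [trivial | lra |].
    intros X o a b c HX Ha Hb Hc Hab Hac Hbc Eb Ec.
    pose proof (separable_half_gap lam rho X (Rlt_le _ _ hrho) HX) as G.
    pose proof (circumcircle_heron o a b c _ eq_refl (eq_sym Eb) (eq_sym Ec)) as E.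
    rewrite Es; replace (sq_circumradius _ _) with (4 * sinh rho ^ 2 / 3)
      by (unfold sq_circumradius; field; lra).
    apply (regular_bound _ _ (half_gap a b) (half_gap a c) (half_gap b c)); auto.
    assert (o <> a \/ o <> b) as [H|H]
      by (destruct (classic (o = a)); [right; congruence | now left]);
      apply lor_gt_1 in H; nra.
Qed.
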